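(* Let $Q_n^{(p)}$, $Q_n^{(p,q)}$ and $A_n^{(p,r)}$ be the numbers defined in the context. Then for all $p\geq 1$, $q\geq 1$ and $n\geq 1$, $$Q_n^{(p,q)}=\sum_{r=1}^{n}\ \sum_{k=0}^{n-r-q}A_k^{(p,r)}\,Q_{n-k}^{(r+q-1)}$$ (where an inner sum with negative upper limit is zero), and for all $r\geq 1$, $p\geq 1$ and $n\geq 1$, $$A_n^{(p,r)}=A_n^{(\max(p-1,1),\,r-1)}+\sum_{k=0}^{n-1}A_k^{(1,r-1)}\,A_{n-k}^{(p,1)}.$$
   Context: A planar map is a finite connected graph (loops and multiple edges allowed) properly embedded in the two-dimensional sphere, considered up to continuous (orientation-preserving) deformation. It is rooted if an oriented edge is distinguished. The degree of a face is the number of sides of its underlying polygon (an edge with the same face on both sides is counted twice). $Q_n^{(p)}$: for $p\geq 1$, the number of rooted planar maps with $n$ vertices in which the face to the right of the root edge (the boundary, or external face, not necessarily simple) has degree $2p$ and all other faces have degree $4$. By convention $Q_1^{(0)}=1$ (the single-vertex map) and $Q_n^{(0)}=0$ for $n\geq 2$. $Q_n^{(p,q)}$ ($p,q\geq 1$): the number of rooted planar maps with $n$ vertices in which the face to the right of the root edge has degree $2p$, together with a distinguished face, different from the external face, of degree $2q$ (carrying no root of its own), all other faces having degree $4$. $A_n^{(p,r)}$ for $r\geq 1$, $p\geq 1$, $n\geq 0$: the number of finite rooted plane trees with nonnegative integer labels on the vertices, with one distinguished leaf, such that: the root has label $p$; the distinguished leaf has label $r$; there are exactly $n$ other leaves,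 all with label $0$; every non-leaf vertex has a label $\ell\geq 1$ and has either exactly one child, with label $\ell+1$, or exactly two (ordered) children, with labels $\ell_1,\ell_2\geq 0$ satisfying $\ell_1+\ell_2+1=\ell$. (In particular $A_0^{(p,r)}$ equals $1$ if $r\geq p$ and $0$ otherwise.) For $r=0$ and $p\geq 1$: $A_n^{(p,0)}=(n+1)\,Q_{n+1}^{(p)}$ if $n\geq\max(1,p-1)$, and $A_n^{(p,0)}=0$ otherwise. *)

(* Defs.v *)
From HB Require Import structures.
From mathcomp Require Import all_boot all_fingroup.
From mathcomp Require Import finmap.
From mathcomp Require Import boolp classical_sets functions cardinality.

Set Implicit Arguments.
Unset Strict Implicit.
Unset Printing Implicit Defensive.

(* [fset_set A] is the finite set of the elements of [A] when [A] is finite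
   (and is empty otherwise); it is only meant to be used on finite sets. *)
Definition ncard (T : choiceType) (A : set T) : nat := #|` fset_set A|.

(* A map with at least one edge on an oriented surface is encoded by its set of
   darts (oriented edges), on which [vperm] sends a dart to the next dart,
   counterclockwise, around its origin, and [eperm] reverses a dart. *)
Record rmap := RMap {
  ndart : nat;
  vperm : {perm 'I_ndart};
  eperm : {perm 'I_ndart};
  root : 'I_ndart }.

(* In MathComp [(s * t)%g d = t (s d)], so [face_perm m] sends a dart [d] to
   [vperm m (eperm m d)]: the dart that follows [d] along the face on the
   right of [d]. A cycle of [face_perm m] is thus a face, listed as the set of
   the darts that have it on their right, and its cardinality is its degree. *)
Definition face_perm (m : rmap) : {perm 'I_(ndart m)} := (eperm m * vperm m)%g.

Definition vertices (m : rmap) : {set {set 'I_(ndart m)}} := porbits (vperm m).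
Definition edges (m : rmap) : {set {set 'I_(ndart m)}} := porbits (eperm m).
Definition faces (m : rmap) : {set {set 'I_(ndart m)}} := porbits (face_perm m).

Definition root_face (m : rmap) : {set 'I_(ndart m)} :=
  porbit (face_perm m) (root m).

Definition dart_step (m : rmap) : rel 'I_(ndart m) :=
  fun d d' => (d' == vperm m d) || (d' == eperm m d).

(* Planarity is genus 0, expressed by Euler's formula. *)
Definition planar_map (m : rmap) : Prop :=
  [/\ forall d, eperm m d != d,
      forall d, eperm m (eperm m d) = d,
      forall d d', connect (dart_step (m := m)) d d'
    & #|vertices m| + #|faces m| = #|edges m| + 2].

Definition rmap_isomorphism (m m' : rmap)
    (f : 'I_(ndart m) -> 'I_(ndart m')) : Prop :=
  [/\ bijective f,
      forall d, f (vperm m d) = vperm m' (f d),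
      forall d, f (eperm m d) = eperm m' (f d)
    & f (root m) = root m'].

(* Embedded rooted maps are equal up to orientation-preserving deformation iff
   their encodings are isomorphic. *)
Definition rmap_iso (m m' : rmap) : Prop :=
  exists f, @rmap_isomorphism m m' f.

Record fmap := FMap {
  base : rmap;
  mface : {set 'I_(ndart base)} }.

Definition fmap_iso (x y : fmap) : Prop :=
  exists2 f, @rmap_isomorphism (base x) (base y) f & f @: mface x = mface y.

Definition is_quad_boundary (n p : nat) (m : rmap) : Prop :=
  [/\ planar_map m,
      #|vertices m| = n,
      #|root_face m| = p.*2
    & forall F, F \in faces m -> F != root_face m -> #|F| = 4].

Definition is_quad_boundary_face (n p q : nat) (x : fmap) : Prop :=
  let m := base x in
  [/\ planar_map m,
      #|vertices m| = n,
      #|root_face m| = p.*2,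
      [/\ mface x \in faces m, mface x != root_face m & #|mface x| = q.*2]
    & forall F, F \in faces m -> F != root_face m -> F != mface x ->
        #|F| = 4].

(* Every non-leaf vertex has one child or two ordered children; the boolean of
   a leaf tells whether this leaf is the distinguished one. *)
Inductive ltree :=
  | Leaf of nat & bool
  | Unary of nat & ltree
  | Binary of nat & ltree & ltree.

HB.instance Definition _ := gen_eqMixin ltree.
HB.instance Definition _ := gen_choiceMixin ltree.

Definition label (t : ltree) : nat :=
  match t with Leaf l _ => l | Unary l _ => l | Binary l _ _ => l end.

Fixpoint count_leaves (b : bool) (t : ltree) : nat :=
  match t with
  | Leaf _ b' => b' == b
  | Unary _ t1 => count_leaves b t1
  | Binary _ t1 t2 => count_leaves b t1 + count_leaves b t2
  end.

Fixpoint well_labeled (r : nat) (t : ltree) : Prop :=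
  match t with
  | Leaf l b => l = if b then r else 0
  | Unary l t1 => [/\ 1 <= l, label t1 = l.+1 & well_labeled r t1]
  | Binary l t1 t2 =>
      [/\ 1 <= l, label t1 + label t2 + 1 = l,
          well_labeled r t1 & well_labeled r t2]
  end.

Definition is_tree_A (n p r : nat) (t : ltree) : Prop :=
  [/\ label t = p, well_labeled r t,
      count_leaves true t = 1 & count_leaves false t = n].

Local Open Scope classical_set_scope.

Definition classes (T : Type) (eqv : T -> T -> Prop) (P : T -> Prop) :
    set (set T) :=
  [set [set y | eqv x y] | x in P].

(* $Q_n^{(p)}$; the single-vertex map has no dart and is dealt with apart. *)
Definition numQ (n p : nat) : nat :=
  if p is 0 then (n == 1)%N
  else ncard (classes rmap_iso (is_quad_boundary n p)).

(* $Q_n^{(p,q)}$ *)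
Definition numQ2 (n p q : nat) : nat :=
  ncard (classes fmap_iso (is_quad_boundary_face n p q)).

(* $A_n^{(p,r)}$, for $p \geq 1$ *)
Definition numA (n p r : nat) : nat :=
  if r is 0 then
    if (maxn 1 p.-1 <= n)%N then (n.+1 * numQ n.+1 p)%N else 0
  else ncard [set t | is_tree_A n p r t].

(* Main.v *)
Require Import Defs.
From mathcomp Require Import all_boot.
From HB Require Import structures.
From mathcomp Require Import all_fingroup zify boolp.

(** Mark the root corner of a rooted planar map by a leg, a dart that is its own
    reverse; the lone leg is the single-vertex map. Deleting the root edge of a
    legged map leaves either a connected map, from which the edge cut a face off
    the root face, or two legged maps. This encodes the planar maps bijectively
    by trees, whose unary vertices carry the degree of the face that is cut off.
    That both pieces are planar, and that the edge cuts a face off when the map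
    stays connected, comes from Euler's inequality, which the same decomposition
    proves by induction.

    For quadrangulations these trees are the labelled trees of the statement, a
    map whose root face has degree 2p giving a root of label p and the vertices
    giving the leaves of label 0. When a marked face of degree 2q is cut off at a
    vertex of label r, the subtree below has label r + q - 1: cutting the tree
    there gives the first identity.

    The branch from the root to the distinguished leaf of a tree counted by
    A^(p,r) is a walk on the labels, from p to r, with steps +1 and -(j+1), the
    latter weighted by twice the series of the Q^(j); the walks stay positive,
    or, for r = 0, stop when they reach 0. Splitting a walk at its last visit to
    1, if any, gives the second identity. *)

(** The leg makes the decomposition uniform: the single-vertex map has a dart too, each piece left
    by the deletion of the root edge has its own leg, and an isomorphism respecting legs restricts
    to the pieces. Isomorphism classes can thus be counted by plain trees, without choosing
    representatives. Both cases go through one operation, [bridge], which acts on face permutations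
    by a transposition: it splits one cycle or merges two, so that every change in Euler's formula
    is read off from one membership test.

    Walks are never formed as objects. The two sides of the second identity are shown to solve the
    same linear recursion, and a solution that vanishes for large labels is unique. The factor 2 in
    the weight of a downward step has two origins. For [r > 0] the branch to the distinguished leaf
    goes to the left or to the right child. For [r = 0] the numbers [(n+1) Q_{n+1}] are the
    coefficients of the derivative of the series of the [Q_n], and Leibniz' rule turns the quadratic
    recursion of the latter into a linear one with two equal sums. *)

Set Implicit Arguments.
Unset Strict Implicit.
Unset Printing Implicit Defensive.

(** * Orbits of permutations *)

Section PermOrbits.
Variable T : finType.
Implicit Types (s : {perm T}) (A : {set T}) (x y : T).

Lemma porbit_step s x : porbit s (s x) = porbit s x.
Proof. exact: (porbit_perm s 1 x). Qed.

Lemma mem_porbit_step s x y : (s y \in porbit s x) = (y \in porbit s x).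
Proof. by rewrite porbit_sym porbit_step porbit_sym. Qed.

Lemma porbit_closed s A x :
  x \in A -> {in A, forall y, s y \in A} -> porbit s x \subset A.
Proof.
move=> Ax As; apply/subsetP => _ /porbitP [i ->].
by elim: i => [|i IH]; rewrite ?expg0 ?perm1 // expgSr permM As.
Qed.

(** Orbits are finite, so a set closed under [s] also contains the preimages of its points; this is
    why complements of closed sets are closed. *)
Lemma perm_closed_mem s A : {in A, forall y, s y \in A} ->
  forall y, (s y \in A) = (y \in A).
Proof.
move=> As y; apply/idP/idP; last exact: As.
move/porbit_closed/(_ As)/subsetP; apply.
by rewrite porbit_step porbit_id.
Qed.

Lemma perm_closed_setC s A : {in A, forall y, s y \in A} ->
  {in ~: A, forall y, s y \in ~: A}.
Proof. by move=> As y; rewrite !inE perm_closed_mem. Qed.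

Lemma porbit_const (U : Type) s (c : T -> U) x y :
  (forall z, c (s z) = c z) -> y \in porbit s x -> c y = c x.
Proof.
move=> Hc /porbitP [i ->]; elim: i => [|i IH]; first by rewrite expg0 perm1.
by rewrite expgSr permM Hc.
Qed.

Lemma porbit_fcycle s x l : fcycle s l -> uniq l -> x \in l -> porbit s x =i l.
Proof.
move=> cl ul xl y; apply/idP/idP.
  have As : {in [set z in l], forall z, s z \in [set z in l]}.
    by move=> z; rewrite !inE => zl; have /eqP -> := next_cycle cl zl; rewrite mem_next.
  have := porbit_closed (s := s) (A := [set z in l]) (x := x).
  by rewrite !inE => /(_ xl As)/subsetP /(_ y); rewrite inE.
case/rot_to: xl => i l' El yl.
have {cl}: fcycle s (x :: l') by rewrite -El rot_cycle.
rewrite /= rcons_path => /andP [pl _].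
have {}yl: y \in x :: l' by rewrite -El mem_rot.
have [i'] : exists i, y = iter i s x.
  move: yl pl; rewrite inE => /predU1P [->|]; first by exists 0.
  move=> yl /fpathP [n El']; move: yl; rewrite El' => /trajectP [k _ ->].
  by exists k.+1; rewrite iterSr.
by move=> ->; rewrite -permX mem_porbit.
Qed.

Lemma card_porbit_fcycle s x l :
  fcycle s l -> uniq l -> x \in l -> #|porbit s x| = size l.
Proof.
by move=> cl ul xl; rewrite (eq_card (porbit_fcycle cl ul xl)) (card_uniqP ul).
Qed.

Lemma fcycle_porbit s x : fcycle s (traject s x #|porbit s x|).
Proof.
case: #|porbit s x| (card_porbit_neq0 s x) (iter_porbit s x) => [|n] // _ H.
rewrite /= -[X in rcons _ X]H iterSr -trajectSr.
exact: fpath_traject.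
Qed.

End PermOrbits.

(** Commutation is asked on one orbit only: a new edge changes the face permutation on the faces it
    touches and nowhere else. *)
Lemma porbit_in_morph (T T' : finType) (g : T -> T') (s : {perm T})
    (s' : {perm T'}) x :
  {in porbit s x, forall y, s' (g y) = g (s y)} ->
  porbit s' (g x) = g @: porbit s x.
Proof.
move=> H; apply/eqP; rewrite eqEsubset; apply/andP; split.
  apply: porbit_closed; first by rewrite imset_f ?porbit_id.
  move=> _ /imsetP [y Hy ->]; rewrite H // imset_f //.
  by rewrite mem_porbit_step.
apply/subsetP => _ /imsetP [_ /porbitP [i ->] ->].
elim: i => [|i IH]; first by rewrite expg0 perm1 porbit_id.
by rewrite expgSr permM -H ?mem_porbit_step ?mem_porbit.
Qed.

Lemma porbit_morph (T T' : finType) (g : T -> T') (s : {perm T})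
    (s' : {perm T'}) x :
  (forall y, s' (g y) = g (s y)) -> porbit s' (g x) = g @: porbit s x.
Proof. by move=> H; apply: porbit_in_morph => y _. Qed.

Lemma porbits_bij (T T' : finType) (g : T -> T') (s : {perm T})
    (s' : {perm T'}) : bijective g -> (forall y, s' (g y) = g (s y)) ->
  #|porbits s'| = #|porbits s|.
Proof.
move=> [h gK hK] H; rewrite -(card_imset (porbits s) (imset_inj (can_inj gK))).
apply: eq_card => A; apply/imsetP/imsetP => [[y _ ->]|[_ /imsetP[x _ ->] ->]].
  exists (porbit s (h y)); first by rewrite imset_f.
  by rewrite -(@porbit_morph _ _ g s s' (h y) H) hK.
by exists (g x); rewrite // (@porbit_morph _ _ g s s' x H).
Qed.

(* [Some_inj] of the library is about a [nonPropType], which often cannot be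
   inferred from a [finType]. *)
Lemma some_inj {T : Type} : injective (@Some T).
Proof. by move=> x y []. Qed.

(** * Insertion of a point into a permutation, and disjoint sums *)

Section PermConstructions.

Variables T T1 T2 : finType.

Lemma omap_perm_inj (s : {perm T}) : injective (omap s).
Proof. by apply: inj_omap; exact: perm_inj. Qed.

Definition plift (s : {perm T}) : {perm option T} := perm (@omap_perm_inj s).

Lemma pliftS s x : plift s (Some x) = Some (s x).
Proof. by rewrite permE. Qed.

Lemma pliftN s : plift s None = None.
Proof. by rewrite permE. Qed.

Lemma plift_onto (s : {perm option T}) : s None = None -> exists t, s = plift t.
Proof.
move=> sN; pose f x := odflt x (s (Some x)).
have Ef x : s (Some x) = Some (f x).
  rewrite /f; case E: (s (Some x)) => [y|] //.
  by move: E; rewrite -sN => /perm_inj.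
have fI : injective f.
  by move=> x y E; have /perm_inj[] : s (Some x) = s (Some y) by rewrite !Ef E.
by exists (perm fI); apply/permP => -[x|]; rewrite ?pliftN ?pliftS ?permE.
Qed.

Lemma porbit_pliftS s x : porbit (plift s) (Some x) = Some @: porbit s x.
Proof. by apply: porbit_morph => y; rewrite pliftS. Qed.

Lemma porbit_pliftN s : porbit (plift s) None = [set None].
Proof.
apply/eqP; rewrite eqEsubset sub1set porbit_id andbT.
apply: porbit_closed; rewrite ?set11 // => y /set1P ->.
by rewrite pliftN set11.
Qed.

Lemma card_porbits_plift s : #|porbits (plift s)| = #|porbits s|.+1.
Proof.
rewrite -(card_imset (porbits s) (imset_inj (@some_inj T))).
have -> : porbits (plift s) =
    [set None] |: [set [set Some x | x in (A : {set T})] | A in porbits s].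
  apply/setP => A; apply/imsetP/setU1P.
    case=> -[x|] _ ->; [right|by left; rewrite porbit_pliftN].
    by rewrite porbit_pliftS; apply: imset_f; apply: imset_f.
  case=> [->|/imsetP [_ /imsetP[x _ ->] ->]].
    by exists None; rewrite ?porbit_pliftN.
  by exists (Some x); rewrite ?porbit_pliftS.
rewrite cardsU1; case: imsetP => // -[_ /imsetP[x _ ->]] /setP /(_ None).
by rewrite set11 => /esym /imsetP [].
Qed.

(* [ins s a] inserts [None] just after [a] in its cycle. *)
Definition ins (s : {perm T}) a : {perm option T} :=
  (tperm (Some a) None * plift s)%g.

Lemma insN s a : ins s a None = Some (s a).
Proof. by rewrite permM tpermR pliftS. Qed.

Lemma insS s a x : ins s a (Some x) = if x == a then None else Some (s x).
Proof.
rewrite permM; case: eqP => [->|/eqP H]; first by rewrite tpermL pliftN.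
by rewrite tpermD ?pliftS // eq_sym.
Qed.

Lemma insS_eq s a : ins s a (Some a) = None.
Proof. by rewrite insS eqxx. Qed.

Lemma insS_neq s a x : x != a -> ins s a (Some x) = Some (s x).
Proof. by rewrite insS => /negPf ->. Qed.

Lemma ins_onto (s : {perm option T}) :
  s None != None -> exists t a, s = ins t a.
Proof.
move=> sN; case E: ((s^-1)%g None) => [a|]; last by rewrite -{1}E permKV eqxx in sN.
have sa : s (Some a) = None by rewrite -E permKV.
have [|t Et] := @plift_onto (tperm (Some a) None * s)%g.
  by rewrite permM tpermR.
by exists t, a; rewrite /ins -Et mulgA tperm2 mul1g.
Qed.

(** With [s] reversing darts and [t] turning around vertices, this locates on its face a dart
    inserted at a vertex: it comes after the reverse of the dart that precedes it around the
    vertex. *)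
Lemma plift_mul_ins (s t : {perm T}) a :
  (plift s * ins t a)%g = ins (s * t) (s^-1 a)%g.
Proof.
apply/permP => -[x|]; last by rewrite permM pliftN !insN permM permKV.
rewrite permM pliftS !insS permM.
by rewrite -[in RHS](inj_eq (@perm_inj _ s)) permKV.
Qed.

Lemma porbit_insS s a y : porbit (ins s a) (Some y) =
  Some @: porbit s y :|: (if a \in porbit s y then [set None] else set0).
Proof.
have sub x z : x \in porbit s z -> Some x \in porbit (ins s a) (Some z).
  move=> xz; have := porbit_closed (s := s) (x := z)
    (A := [set x | Some x \in porbit (ins s a) (Some z)]).
  rewrite inE porbit_id => /(_ isT) H.
  have {H} /subsetP /(_ x xz) : porbit s z \subset
     [set x | Some x \in porbit (ins s a) (Some z)]; last by rewrite inE.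
  apply: H => w; rewrite !inE => Hw; case: (eqVneq w a) => [E|wa].
    rewrite -E in Hw *; rewrite -(insN s w) mem_porbit_step.
    by rewrite -(insS_eq s w) mem_porbit_step.
  by rewrite -(insS_neq s wa) mem_porbit_step.
apply/eqP; rewrite eqEsubset; apply/andP; split; last first.
  rewrite subUset; apply/andP; split.
    by apply/subsetP => _ /imsetP [x xy ->]; exact: sub.
  case: ifP => ay; last exact: sub0set.
  by rewrite sub1set -(insS_eq s a) mem_porbit_step sub.
apply: porbit_closed; first by rewrite inE imset_f ?porbit_id.
case=> [x|].
  rewrite inE => /orP [/imsetP [z zy [->]]|]; last by case: ifP; rewrite inE.
  rewrite insS; case: eqP => [E|_].
    by rewrite -E zy inE inE eqxx orbT.
  by rewrite inE imset_f ?mem_porbit_step.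
rewrite insN inE; case/orP; first by case/imsetP.
case: ifP => [ay _|]; last by rewrite inE.
by rewrite inE imset_f // mem_porbit_step.
Qed.

Lemma porbit_insN s a : porbit (ins s a) None = None |: Some @: porbit s a.
Proof.
by rewrite -(insS_eq s a) porbit_step porbit_insS porbit_id setUC insS_eq.
Qed.

Lemma mem_porbit_insSS s a x y :
  (Some x \in porbit (ins s a) (Some y)) = (x \in porbit s y).
Proof.
rewrite porbit_insS inE (mem_imset _ _ some_inj); case: ifP => _; rewrite !inE ?orbF //.
Qed.

Lemma mem_porbit_insNS s a y :
  (None \in porbit (ins s a) (Some y)) = (a \in porbit s y).
Proof. by rewrite -(insS_eq s a) mem_porbit_step mem_porbit_insSS. Qed.

Lemma mem_porbit_insSN s a y :
  (Some y \in porbit (ins s a) None) = (a \in porbit s y).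
Proof. by rewrite -(insS_eq s a) porbit_step mem_porbit_insSS porbit_sym. Qed.

(** The transposition merges the fixed point [None] with the cycle of [a], which undoes the extra
    orbit of [plift]. *)
Lemma card_porbits_ins s a : #|porbits (ins s a)| = #|porbits s|.
Proof.
move: (porbits_mul_tperm (plift s) (Some a) None) => /=.
rewrite -/(ins s a) porbit_pliftN inE /= card_porbits_plift.
by rewrite -[1.*2]/2 addn1 addn2 => -[].
Qed.

Definition sum_fun (s1 : {perm T1}) (s2 : {perm T2}) (x : T1 + T2) : T1 + T2 :=
  match x with inl y => inl (s1 y) | inr y => inr (s2 y) end.

Lemma sum_fun_inj s1 s2 : injective (sum_fun s1 s2).
Proof. by move=> [x|x] [y|y] //= [] /perm_inj ->. Qed.

Definition psum s1 s2 : {perm T1 + T2} := perm (@sum_fun_inj s1 s2).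

Lemma psumL s1 s2 x : psum s1 s2 (inl x) = inl (s1 x).
Proof. by rewrite permE. Qed.

Lemma psumR s1 s2 x : psum s1 s2 (inr x) = inr (s2 x).
Proof. by rewrite permE. Qed.

Lemma psumM s1 s2 t1 t2 : (psum s1 s2 * psum t1 t2)%g = psum (s1 * t1) (s2 * t2).
Proof. by apply/permP => -[x|x]; rewrite permM !(psumL, psumR) permM. Qed.

Lemma porbit_psumL s1 s2 x : porbit (psum s1 s2) (inl x) = inl @: porbit s1 x.
Proof. by apply: porbit_morph => y; rewrite psumL. Qed.

Lemma porbit_psumR s1 s2 x : porbit (psum s1 s2) (inr x) = inr @: porbit s2 x.
Proof. by apply: porbit_morph => y; rewrite psumR. Qed.

Lemma card_porbits_psum s1 s2 :
  #|porbits (psum s1 s2)| = #|porbits s1| + #|porbits s2|.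
Proof.
rewrite -(card_imset (porbits s1) (imset_inj (@inl_inj T1 T2))).
rewrite -(card_imset (porbits s2) (imset_inj (@inr_inj T1 T2))).
rewrite -cardsUI [X in _ = _ + X](_ : _ = 0) ?addn0.
  apply: eq_card => A; apply/imsetP/setUP.
    case=> -[x|x] _ ->; [left|right]; rewrite ?porbit_psumL ?porbit_psumR;
    by apply: imset_f; apply: imset_f.
  by case=> /imsetP[_ /imsetP[x _ ->] ->]; [exists (inl x)|exists (inr x)];
    rewrite ?porbit_psumL ?porbit_psumR.
apply/eqP; rewrite cards_eq0; apply/eqP/setP => A; rewrite !inE.
apply/negP => /andP [/imsetP[_ /imsetP[x _ ->] ->] /imsetP[B _ E]].
have: inl x \in inl (B := T2) @: porbit s1 x by rewrite imset_f ?porbit_id.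
by rewrite E => /imsetP [].
Qed.

End PermConstructions.

(** The place of insertion is intrinsic, being the predecessor of [None]; a conjugation that fixes
    [None] therefore carries it along. *)
Lemma ins_iso_inj (T T' : finType) (s : {perm T}) (s' : {perm T'}) a a'
    (h : option T -> option T') (g : T -> T') : injective g ->
  h None = None -> (forall x, h (Some x) = Some (g x)) ->
  (forall z, h (ins s a z) = ins s' a' (h z)) ->
  (forall x, g (s x) = s' (g x)) /\ g a = a'.
Proof.
move=> gI hN hS H; have ga : g a = a'.
  have := H (Some a); rewrite insS_eq hN hS insS.
  by case: eqP.
split=> // x; apply: (@some_inj T'); rewrite -hS.
case: (eqVneq x a) => [->|xa]; first by rewrite -(insN s) H hN insN ga.
by rewrite -(insS_neq s xa) H hS insS_neq // -ga (inj_eq gI).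
Qed.

Lemma ins_functor (T T' : finType) (s : {perm T}) (s' : {perm T'}) a (g : T -> T') :
  injective g -> (forall x, g (s x) = s' (g x)) ->
  forall z, omap g (ins s a z) = ins s' (g a) (omap g z).
Proof.
move=> gI gs [x|] /=; last by rewrite !insN /= gs.
by rewrite !insS (inj_eq gI); case: ifP => //= _; rewrite gs.
Qed.

(** * Legged maps *)

(* The darts of a legged map are those of a rooted map together with one more
   dart, the leg, which marks the root corner: the root dart is the one that
   follows the leg around its vertex. The single-vertex map is a lone leg. *)
Record lmap := LMap {
  ldart :> finType; lv : {perm ldart}; le : {perm ldart}; lr : ldart }.

(* A map with two legs, not necessarily connected. *)
Record tmap := TMap {
  tdart :> finType; tv : {perm tdart}; te : {perm tdart};
  tr : tdart; td : tdart }.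

Arguments LMap : clear implicits.
Arguments TMap : clear implicits.

Definition lf (M : lmap) : {perm M} := (le M * lv M)%g.
Definition tf (S : tmap) : {perm S} := (te S * tv S)%g.

(** Connectedness as an induction principle rather than by paths, so that it passes from one map to
    another by pulling closed sets back. *)
Definition pconn (T : finType) (v e : {perm T}) (r : T) : Prop :=
  forall A : {set T}, r \in A -> {in A, forall x, v x \in A} ->
    {in A, forall x, e x \in A} -> forall x, x \in A.

Definition lconn (M : lmap) := pconn (lv M) (le M) (lr M).
Definition tconn (S : tmap) := pconn (tv S) (te S) (tr S).

Definition linv (M : lmap) : Prop :=
  involutive (le M) /\ forall x, (le M x == x) = (x == lr M).
Definition tinv (S : tmap) : Prop :=
  [/\ involutive (te S), forall x, (te S x == x) = (x == tr S) || (x == td S)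
    & tr S != td S].

Definition liso (M N : lmap) (g : M -> N) : Prop :=
  [/\ bijective g, forall x, g (lv M x) = lv N (g x),
      forall x, g (le M x) = le N (g x) & g (lr M) = lr N].
Definition tiso (S R : tmap) (g : S -> R) : Prop :=
  [/\ bijective g, forall x, g (tv S x) = tv R (g x),
      forall x, g (te S x) = te R (g x), g (tr S) = tr R & g (td S) = td R].

(* The inverse of the deletion of the root edge: [None] is the new root dart,
   inserted after the leg [tr S], and its reverse is the leg [td S]. *)
Definition bridge (S : tmap) : lmap :=
  LMap (option S) (ins (tv S) (tr S))
    (tperm None (Some (td S)) * plift (te S))%g (Some (tr S)).

(* What is left by the deletion of the root edge, whose other end is the second
   leg, when it is connected ([amap], where [x] is the dart before this leg
   around its vertex) and when it is not ([jmap]). *)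
Definition amap (M : lmap) (x : M) : tmap :=
  TMap (option M) (ins (lv M) x) (plift (le M)) (Some (lr M)) None.

Definition jmap (M N : lmap) : tmap :=
  TMap (M + N)%type (psum (lv M) (lv N)) (psum (le M) (le N))
    (inl (lr M)) (inr (lr N)).

Lemma liso_id (M : lmap) : liso (@id M).
Proof. by split=> //; exists id. Qed.

Lemma liso_comp (M N P : lmap) (g : M -> N) (h : N -> P) :
  liso g -> liso h -> liso (h \o g).
Proof.
move=> [bg vg eg rg] [bh vh eh rh]; split; first exact: bij_comp.
- by move=> x /=; rewrite vg vh.
- by move=> x /=; rewrite eg eh.
- by rewrite /= rg rh.
Qed.

Lemma liso_inv (M N : lmap) (g : M -> N) : liso g ->
  exists h, [/\ liso (h : N -> M), cancel g h & cancel h g].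
Proof.
move=> [[h gK hK] vg eg rg]; exists h; split=> //; split.
- by exists g.
- by move=> x; apply: (can_inj gK); rewrite vg !hK.
- by move=> x; apply: (can_inj gK); rewrite eg !hK.
- by rewrite -rg gK.
Qed.

Lemma liso_f (M N : lmap) (g : M -> N) : liso g -> forall x, lf N (g x) = g (lf M x).
Proof. by case=> _ vg eg _ x; rewrite !permM vg eg. Qed.

Lemma liso_inj (M N : lmap) (g : M -> N) : liso g -> injective g.
Proof. by case=> /bij_inj. Qed.

Lemma liso_porbit (M N : lmap) (g : M -> N) : liso g ->
  forall x, porbit (lf N) (g x) = g @: porbit (lf M) x.
Proof. by move=> H x; apply: porbit_morph => y; rewrite liso_f. Qed.

Lemma liso_linv (M N : lmap) (g : M -> N) : liso g -> linv M -> linv N.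
Proof.
move=> H; case: (H) => [[h gK hK] vg eg rg] [i1 i2]; split=> x.
  by rewrite -(hK x) -!eg i1.
by rewrite -(hK x) -eg -rg !(inj_eq (can_inj gK)).
Qed.

Lemma liso_lconn (M N : lmap) (g : M -> N) : liso g -> lconn M -> lconn N.
Proof.
move=> [[h gK hK] vg eg rg] cM A Ar Av Ae x; rewrite -(hK x).
have := cM [set y | g y \in A] _ _ _ (h x); rewrite !inE; apply.
- by rewrite rg.
- by move=> y; rewrite !inE vg => /Av.
- by move=> y; rewrite !inE eg => /Ae.
Qed.

Lemma tiso_tconn (S R : tmap) (g : S -> R) : tiso g -> tconn S -> tconn R.
Proof.
move=> [[h gK hK] vg eg rg _] cM A Ar Av Ae x; rewrite -(hK x).
have := cM [set y | g y \in A] _ _ _ (h x); rewrite !inE; apply.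
- by rewrite rg.
- by move=> y; rewrite !inE vg => /Av.
- by move=> y; rewrite !inE eg => /Ae.
Qed.

Lemma liso_card (M N : lmap) (g : M -> N) : liso g -> 
  [/\ #|porbits (lv N)| = #|porbits (lv M)|,
      #|porbits (le N)| = #|porbits (le M)|,
      #|porbits (lf N)| = #|porbits (lf M)| & #|N| = #|M|].
Proof.
move=> H; case: (H) => bg vg eg _; split; try by apply: (@porbits_bij _ _ g).
  by apply: (@porbits_bij _ _ g) => //; exact: liso_f.
by rewrite (bij_eq_card bg).
Qed.

(* Euler's formula: the leg is a fixed point of [le], hence counts as an edge. *)
Definition lplanar (M : lmap) : Prop :=
  #|porbits (lv M)| + #|porbits (lf M)| = #|porbits (le M)| + 1.

Lemma liso_lplanar (M N : lmap) (g : M -> N) : liso g -> lplanar M -> lplanar N.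
Proof. by case/liso_card; rewrite /lplanar => -> -> ->. Qed.

Section Bridge.
Variable S : tmap.
Hypothesis iS : tinv S.

Lemma te_r : te S (tr S) = tr S.
Proof. by case: iS => _ H _; apply/eqP; rewrite H eqxx. Qed.

Lemma te_d : te S (td S) = td S.
Proof. by case: iS => _ H _; apply/eqP; rewrite H eqxx orbT. Qed.

Lemma bridge_eN : le (bridge S) None = Some (td S).
Proof. by rewrite permM tpermL pliftS te_d. Qed.

Lemma bridge_ed : le (bridge S) (Some (td S)) = None.
Proof. by rewrite permM tpermR pliftN. Qed.

Lemma bridge_eS x : x != td S -> le (bridge S) (Some x) = Some (te S x).
Proof. by move=> xd; rewrite permM tpermD ?pliftS // eq_sym. Qed.

Lemma bridge_linv : linv (bridge S).
Proof.
case: iS => i1 i2 i3; split=> -[x|].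
- case: (eqVneq x (td S)) => [->|xd]; first by rewrite bridge_ed bridge_eN.
  rewrite (bridge_eS xd) bridge_eS ?i1 //.
  by apply: contra xd => /eqP /(congr1 (te S)); rewrite i1 te_d => ->.
- by rewrite bridge_eN bridge_ed.
- case: (eqVneq x (td S)) => [->|xd].
    by rewrite bridge_ed; apply/esym/negbTE; apply: contra i3 => /eqP [->].
  by rewrite (bridge_eS xd) !(inj_eq (@some_inj _)) i2 (negPf xd) orbF.
- by rewrite bridge_eN.
Qed.

(** Since [None] lies on the face of the first leg, the transposition splits that face if the second
    leg is on it too, and merges the faces of the two legs otherwise. *)
Lemma bridge_lf : lf (bridge S) =
  (tperm None (Some (td S)) * ins (tf S) (tr S))%g.
Proof.
rewrite /lf /= -mulgA plift_mul_ins; congr (_ * ins _ _)%g.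
by apply: (@perm_inj _ (te S)); rewrite permKV te_r.
Qed.

Lemma bridge_fN : lf (bridge S) None = ins (tf S) (tr S) (Some (td S)).
Proof. by rewrite bridge_lf permM tpermL. Qed.

Lemma bridge_fd : lf (bridge S) (Some (td S)) = Some (tf S (tr S)).
Proof. by rewrite bridge_lf permM tpermR insN. Qed.

Lemma bridge_fS x : x != td S -> lf (bridge S) (Some x) = ins (tf S) (tr S) (Some x).
Proof. by move=> xd; rewrite bridge_lf permM tpermD // eq_sym. Qed.

Lemma bridge_V : #|porbits (lv (bridge S))| = #|porbits (tv S)|.
Proof. exact: card_porbits_ins. Qed.

Lemma bridge_E : #|porbits (le (bridge S))| = #|porbits (te S)|.
Proof.
move: (porbits_mul_tperm (plift (te S)) None (Some (td S))) => /=.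
rewrite card_porbits_plift porbit_pliftS.
case: imsetP => [[]|_] //=.
by rewrite addn1 -[1.*2]/2 addn2 => -[].
Qed.

(** Splitting gives one face more than in [S] and merging one less: the two outcomes differ by
    two. *)
Lemma bridge_F : #|porbits (lf (bridge S))| + (tr S \notin porbit (tf S) (td S)).*2 =
  #|porbits (tf S)|.+1.
Proof.
rewrite bridge_lf.
move: (porbits_mul_tperm (ins (tf S) (tr S)) None (Some (td S))) => /=.
by rewrite mem_porbit_insNS card_porbits_ins addn1.
Qed.

Lemma bridge_lconn : tconn S -> lconn (bridge S).
Proof.
move=> cS A Ar Av Ae; have AN : None \in A by rewrite -(insS_eq (tv S) (tr S)) Av.
have AS x : Some x \in A.
  have := cS [set x | Some x \in A] _ _ _ x; rewrite !inE; apply=> //.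
    move=> y; rewrite !inE => Ay; case: (eqVneq y (tr S)) => [->|yr].
      by rewrite -(insN (tv S)) Av.
    by rewrite -(insS_neq _ yr) Av.
  move=> y; rewrite !inE => Ay; case: (eqVneq y (td S)) => [->|yd].
    by rewrite te_d -bridge_eN Ae.
  by rewrite -(bridge_eS yd) Ae.
by case.
Qed.

(* The two legs meet every component of [S] when the bridge is connected. *)
Lemma bridge_conn2 : lconn (bridge S) ->
  forall A : {set S}, tr S \in A -> td S \in A ->
    {in A, forall x, tv S x \in A} -> {in A, forall x, te S x \in A} ->
    forall x, x \in A.
Proof.
move=> cB A Ar Ad Av Ae x.
have := cB [set y | if y is Some z then z \in A else true] _ _ _ (Some x).
rewrite !inE; apply=> //.
- move=> [y|]; rewrite !inE ?insN; last by rewrite Av.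
  by rewrite insS; case: ifP => // _ /Av.
- move=> [y|]; rewrite !inE; last by rewrite bridge_eN.
  by case: (eqVneq y (td S)) => [->|yd]; rewrite ?bridge_ed // bridge_eS // => /Ae.
Qed.

End Bridge.

Lemma bridge_tinv S : tr S != td S -> linv (bridge S) ->
  te S (td S) = td S -> tinv S.
Proof.
move=> rd [i1 i2] ed.
have eS x : x != td S -> le (bridge S) (Some x) = Some (te S x).
  by move=> xd; rewrite permM tpermD ?pliftS // eq_sym.
have ne x : x != td S -> te S x != td S.
  by apply: contra => /eqP E; apply/eqP/(@perm_inj _ (te S)); rewrite ed.
split=> // x; case: (eqVneq x (td S)) => [->|xd]; rewrite ?ed ?eqxx ?orbT //.
  by apply: (@some_inj S); rewrite -eS ?ne // -eS // i1.
by rewrite orbF -(inj_eq (@some_inj S) (te S x)) -(inj_eq (@some_inj S) x) -eS // i2.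
Qed.

Section Amap.
Variables (M : lmap) (x : M).
Hypothesis iM : linv M.

Lemma amap_tinv : tinv (amap x).
Proof.
case: iM => i1 i2; split=> // -[y|]; rewrite ?(pliftS, pliftN) ?i1 //.
by rewrite (inj_eq (@some_inj _)) i2 orbF.
Qed.

Lemma amap_f : tf (amap x) = ins (lf M) (le M x).
Proof.
rewrite /tf /= plift_mul_ins; congr (ins _ _).
by apply: (@perm_inj _ (le M)); rewrite permKV; case: iM => ->.
Qed.

Lemma amap_card : [/\ #|porbits (tv (amap x))| = #|porbits (lv M)|,
  #|porbits (te (amap x))| = #|porbits (le M)|.+1 &
  #|porbits (tf (amap x))| = #|porbits (lf M)|].
Proof. by rewrite amap_f card_porbits_ins card_porbits_ins card_porbits_plift. Qed.

Lemma amap_same : (tr (amap x) \in porbit (tf (amap x)) (td (amap x))) =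
  (le M x \in porbit (lf M) (lr M)).
Proof. by rewrite amap_f mem_porbit_insSN. Qed.

Lemma amap_tconn : lconn M -> tconn (amap x).
Proof.
move=> cM A Ar Av Ae.
have {}Av : {in A, forall y, ins (lv M) x y \in A} by [].
have AS y : Some y \in A.
  have := cM [set y | Some y \in A] _ _ _ y; rewrite !inE; apply=> //.
    move=> z; rewrite !inE => Ay; case: (eqVneq z x) => [E|zx].
      by rewrite E -(insN (lv M) x) Av // -(insS_eq (lv M) x) Av // -E.
    by rewrite -(insS_neq _ zx) Av.
  by move=> z; rewrite !inE => /Ae; rewrite pliftS.
by case=> [y|] //; rewrite -(insS_eq (lv M) x) Av.
Qed.

Lemma amap_lconn : tconn (amap x) -> lconn M.
Proof.
move=> cM A Ar Av Ae y.
have := cM [set y | if y is Some z then z \in A else x \in A] _ _ _ (Some y).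
rewrite !inE; apply=> //.
- move=> [z|]; rewrite !inE; last by rewrite insN => /Av.
  by rewrite insS; case: eqP => [->|_] // /Av.
- by move=> [z|]; rewrite !inE ?(pliftN, pliftS) // => /Ae.
Qed.

End Amap.

Section Jmap.
Variables (M N : lmap).
Hypothesis (iM : linv M) (iN : linv N).

Lemma jmap_tinv : tinv (jmap M N).
Proof.
case: iM => i1 i2; case: iN => j1 j2; split=> // -[y|y] /=;
  rewrite ?(psumL, psumR) ?i1 ?j1 //.
  by rewrite !(inj_eq (@inl_inj _ _)) i2 orbF.
by rewrite !(inj_eq (@inr_inj _ _)) j2.
Qed.

Lemma jmap_f : tf (jmap M N) = psum (lf M) (lf N).
Proof. exact: psumM. Qed.

Lemma jmap_card :
 [/\ #|porbits (tv (jmap M N))| = #|porbits (lv M)| + #|porbits (lv N)|,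
     #|porbits (te (jmap M N))| = #|porbits (le M)| + #|porbits (le N)| &
     #|porbits (tf (jmap M N))| = #|porbits (lf M)| + #|porbits (lf N)|].
Proof. by rewrite jmap_f !card_porbits_psum. Qed.

Lemma jmap_diff : tr (jmap M N) \notin porbit (tf (jmap M N)) (td (jmap M N)).
Proof. by rewrite jmap_f porbit_psumR; apply/imsetP => -[]. Qed.

Lemma jmap_tconnN : ~ tconn (jmap M N).
Proof.
move=> /(_ [set y | if y is inl _ then true else false]); rewrite !inE.
move=> /(_ isT) H; suff : inr (lr N) \in [set y : M + N | if y is inl _ then true else false].
  by rewrite inE.
by apply: H => -[y|y]; rewrite !inE ?(psumL, psumR).
Qed.

Lemma bridge_jmap_lconn : lconn M -> lconn N -> lconn (bridge (jmap M N)).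
Proof.
move=> cM cN A Ar Av Ae; have iJ := jmap_tinv.
have {}Av : {in A, forall y, ins (psum (lv M) (lv N)) (inl (lr M)) y \in A} by [].
have AL x : Some (inl x) \in A.
  have := cM [set x | Some (inl x) \in A] _ _ _ x; rewrite !inE; apply=> //.
    move=> y; rewrite !inE => Ay; rewrite -(psumL (lv M) (lv N)).
    case: (eqVneq y (lr M)) => [E|yr].
      rewrite E -(insN (psum _ _) (inl (lr M))) Av //.
      by rewrite -(insS_eq (psum (lv M) (lv N)) (inl (lr M))) Av // -E.
    by rewrite -(@insS_neq _ (psum _ _) (inl (lr M))) ?Av // (inj_eq (@inl_inj _ _)).
  move=> y; rewrite !inE => Ay; rewrite -(psumL (le M) (le N)).
  by have /= <- := @bridge_eS (jmap M N) (inl y) isT; rewrite Ae.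
have AN : None \in A by rewrite -(insS_eq (psum (lv M) (lv N)) (inl (lr M))) Av.
have Ad : Some (inr (lr N)) \in A by have /= <- := bridge_eN iJ; rewrite Ae.
have AR x : Some (inr x) \in A.
  have := cN [set x | Some (inr x) \in A] _ _ _ x; rewrite !inE; apply=> //.
    move=> y; rewrite !inE => Ay; rewrite -(psumR (lv M) (lv N)).
    by rewrite -(@insS_neq _ (psum _ _) (inl (lr M))) ?Av.
  move=> y; rewrite !inE => Ay; case: (eqVneq y (lr N)) => [->|yr].
    by have /eqP -> : le N (lr N) == lr N by case: iN => _ ->.
  rewrite -(psumR (le M) (le N)).
  have /= <- := @bridge_eS (jmap M N) (inr y) _; first by rewrite Ae.
  by rewrite (inj_eq (@inr_inj _ _)).
by case=> [[x|x]|].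
Qed.

End Jmap.

(** * Deletion of the root edge *)

Lemma transport_perm (T T' : finType) (g : T -> T') (s : {perm T}) :
  bijective g -> exists s' : {perm T'}, forall x, g (s x) = s' (g x).
Proof.
case=> h gK hK; have I : injective (g \o s \o h).
  by apply: inj_comp; [apply: inj_comp; [exact: can_inj gK|exact: perm_inj]
    |exact: can_inj hK].
by exists (perm I) => x; rewrite permE /= gK.
Qed.

(** Deleting a dart changes the type of darts. The permutations are first transported to a type in
    which this dart is [None], then recognized as coming from the smaller type. *)
Lemma point_split (T : finType) (d : T) :
  exists (T' : finType) (g : T -> option T'), bijective g /\ g d = None.
Proof.
exists {x : T | x != d}, insub; split; last by rewrite insubF ?eqxx.
exists (fun y => if y is Some z then val z else d).
  by move=> x; case: insubP => [u _ <-|] //; rewrite negbK => /eqP.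
by case=> [y|]; rewrite ?valK // insubF ?eqxx.
Qed.

Lemma set_split (T : finType) (C : {set T}) :
  exists (T1 T2 : finType) (g : T -> T1 + T2), bijective g /\
    forall x, (x \in C) = (if g x is inl _ then true else false).
Proof.
pose h (y : {x | x \in C} + {x | x \notin C}) :=
  match y with inl z => val z | inr z => val z end.
have hI : injective h.
  move=> [[y Cy]|[y Cy]] [[z Cz]|[z Cz]] /= E; try by congr (_ _); apply: val_inj.
    by case/negP: (Cz); rewrite -E.
  by case/negP: (Cy); rewrite E.
have hO x : exists y, h y = x.
  case: (boolP (x \in C)) => Cx; first by exists (inl (Sub x Cx)).
  by exists (inr (Sub x Cx)).
have [g Hg] := @choice _ _ (fun x y => h y = x) hO.
exists {x | x \in C}, {x | x \notin C}, g; split.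
  by exists h => // y; apply: hI; rewrite Hg.
move=> x; rewrite -{1}(Hg x); case: (g x) => y /=; first exact: valP.
by case: y => y /= /negPf.
Qed.

Lemma psum_onto (T1 T2 : finType) (s : {perm T1 + T2}) :
  (forall x, exists y, s (inl x) = inl y) ->
  (forall x, exists y, s (inr x) = inr y) ->
  exists s1 s2, s = psum s1 s2.
Proof.
move=> /(@choice _ _ (fun x y => s (inl x) = inl y)) [f1 H1].
move=> /(@choice _ _ (fun x y => s (inr x) = inr y)) [f2 H2].
have I1 : injective f1.
  by move=> x y E; apply: (@inl_inj T1 T2); apply: (@perm_inj _ s); rewrite !H1 E.
have I2 : injective f2.
  by move=> x y E; apply: (@inr_inj T1 T2); apply: (@perm_inj _ s); rewrite !H2 E.
exists (perm I1), (perm I2); apply/permP => -[x|x].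
  by rewrite psumL permE H1.
by rewrite psumR permE H2.
Qed.

(** The dart that follows the leg is sent to [None] and taken out of both permutations; its reverse
    is then fixed by the edge permutation and becomes the second leg. *)
Lemma bridge_onto (M : lmap) : linv M -> lv M (lr M) != lr M ->
  exists S (g : M -> bridge S), liso g /\ tinv S.
Proof.
move=> iM vr; have [T [g [bg gd]]] := point_split (lv M (lr M)).
have [v Hv] := transport_perm (lv M) bg.
have [e He] := transport_perm (le M) bg.
case Er: (g (lr M)) => [r|]; last first.
  by move: vr; rewrite -(inj_eq (bij_inj bg)) gd Er eqxx.
have vR : v (Some r) = None by rewrite -Er -Hv gd.
have vN : v None != None by rewrite -{2}vR (inj_eq (@perm_inj _ v)).
have [v' [a Ev]] := ins_onto vN.
have Ea : a = r.
  by have := insS_eq v' a; rewrite -Ev -vR => /perm_inj [].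
subst a.
case Ed: (e None) => [d|]; last first.
  move: Ed; rewrite -gd -He => /(bij_inj bg)/eqP.
  by case: iM => _ ->; rewrite (negPf vr).
have [|e' Ee] := @plift_onto _ (tperm None (Some d) * e)%g.
  have ed : e (Some d) = None.
    rewrite -Ed -gd -!He; congr g; case: iM => i1 _; exact: i1.
  by rewrite permM tpermL ed.
have {}Ee : e = (tperm None (Some d) * plift e')%g.
  by rewrite -Ee mulgA tperm2 mul1g.
pose S := TMap T v' e' r d.
have gI : liso (g : M -> bridge S).
  by split=> //= x; rewrite ?Hv ?He ?Ev ?Ee.
exists S, g; split=> //; have iB := liso_linv gI iM.
have ed : te S (td S) = td S.
  apply: (@some_inj S); rewrite -pliftS.
  have := Ed; rewrite Ee permM tpermL => ->. by [].
apply: bridge_tinv => //.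
apply/eqP => E; have [_ /(_ (Some (tr S)))] := iB.
by rewrite eqxx /= permM /= /S /= in E *; rewrite E tpermR pliftN.
Qed.

Lemma tconn_amap (S : tmap) : tinv S -> tconn S ->
  exists (M : lmap) x (g : S -> @amap M x), tiso g /\ (linv M /\ lconn M).
Proof.
move=> iS cS; case: (iS) => i1 i2 i3.
have ed : te S (td S) = td S by exact: te_d.
(* A second leg alone at its vertex would be a component of [S] that misses the first leg. *)
have vd : tv S (td S) != td S.
  apply/negP => /eqP vd.
  have := cS (~: [set td S]); rewrite !inE => /(_ i3) H.
  have : td S \in ~: [set td S]; last by rewrite !inE eqxx.
  apply: H; apply: perm_closed_setC => y /set1P ->; rewrite ?vd ?ed set11 //.
have [T [g [bg gd]]] := point_split (td S).
have [v Hv] := transport_perm (tv S) bg.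
have [e He] := transport_perm (te S) bg.
case Er: (g (tr S)) => [r|]; last first.
  by move: i3; rewrite -(inj_eq (bij_inj bg)) gd Er eqxx.
have vN : v None != None by rewrite -gd -Hv (inj_eq (bij_inj bg)).
have [v' [x Ev]] := ins_onto vN.
have [|e' Ee] := @plift_onto _ e; first by rewrite -gd -He ed.
pose M := LMap T v' e' r; exists M, x, g.
have gI : tiso (g : S -> @amap M x).
  by split=> // y /=; rewrite ?Hv ?He ?Ev ?Ee.
have [h gK hK] := bg.
have eS y : Some (e' y) = g (te S (h (Some y))) by rewrite He hK Ee pliftS.
split=> //; split; last first.
  by apply: (@amap_lconn M x); exact: (tiso_tconn gI).
split=> y /=.
  by apply: (@some_inj T); rewrite eS eS gK i1 hK.
rewrite -(inj_eq (@some_inj T)) eS -{2}(hK (Some y)) (inj_eq (bij_inj bg)) i2.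
rewrite -(inj_eq (bij_inj bg)) hK Er (inj_eq (@some_inj T)).
by rewrite -(inj_eq (bij_inj bg)) hK gd orbF.
Qed.

Lemma component (T : finType) (v e : {perm T}) (r : T) :
  exists C : {set T}, [/\ r \in C, {in C, forall x, v x \in C},
    {in C, forall x, e x \in C} &
    forall A : {set T}, r \in A -> {in A, forall x, v x \in A} ->
      {in A, forall x, e x \in A} -> C \subset A].
Proof.
pose cl (A : {set T}) := [&& r \in A, [forall x in A, v x \in A] & [forall x in A, e x \in A]].
exists (\bigcap_(A | cl A) A); split.
- by apply/bigcapP => A /and3P [].
- move=> x /bigcapP H; apply/bigcapP => A cA; case/and3P: (cA) => _ + _.
  by move=> /forall_inP; apply; exact: H.
- move=> x /bigcapP H; apply/bigcapP => A cA; case/and3P: (cA) => _ _.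
  by move=> /forall_inP; apply; exact: H.
move=> A Ar Av Ae; apply: bigcap_inf; rewrite /cl Ar /=.
by apply/andP; split; apply/forall_inP.
Qed.

(** One piece is the component of the first leg. The rest is connected because, by [bridge_conn2],
    every dart is reached from one of the two legs. *)
Lemma tconnN_jmap (S : tmap) : tinv S -> lconn (bridge S) -> ~ tconn S ->
  exists (M N : lmap) (g : S -> jmap M N),
    [/\ tiso g, linv M /\ lconn M & linv N /\ lconn N].
Proof.
move=> iS cB ncS; case: (iS) => i1 i2 i3.
have [C [Cr Cv Ce Cmin]] := component (tv S) (te S) (tr S).
have Cd : td S \notin C.
  apply/negP => Cd; apply: ncS => A Ar Av Ae x.
  have /subsetP := Cmin A Ar Av Ae; apply.
  exact: (bridge_conn2 iS cB Cr Cd Cv Ce).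
have [T1 [T2 [g [bg Cg]]]] := set_split C.
have [v Hv] := transport_perm (tv S) bg.
have [e He] := transport_perm (te S) bg.
case Er: (g (tr S)) => [r|]; last by rewrite Cg Er in Cr.
case Ed: (g (td S)) => [|d]; first by rewrite Cg Ed in Cd.
have [h gK hK] := bg.
have onto (s : {perm S}) (s' : {perm T1 + T2}) : {in C, forall x, s x \in C} ->
    (forall x, g (s x) = s' (g x)) -> exists s1 s2, s' = psum s1 s2.
  move=> Cs Hs; apply: (@psum_onto T1 T2 s') => x.
    have Cx : h (inl x) \in C by rewrite Cg hK.
    have := Cs _ Cx; rewrite Cg Hs hK; case: (s' _) => // y; by exists y.
  have Cx : h (inr x) \notin C by rewrite Cg hK.
  have := perm_closed_mem Cs (h (inr x)).
  by rewrite (negPf Cx) Cg Hs hK; case: (s' _) => // y; exists y.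
have [v1 [v2 Ev]] := onto _ _ Cv Hv; have [e1 [e2 Ee]] := onto _ _ Ce He.
pose M := LMap T1 v1 e1 r; pose N := LMap T2 v2 e2 d.
have eg y : e y = g (te S (h y)) by rewrite He hK.
exists M, N, g; split.
- by split=> // y /=; rewrite ?Hv ?He ?Ev ?Ee.
- split.
    split=> y /=; first by apply: (@inl_inj T1 T2); rewrite -!(psumL e1 e2) -Ee !eg gK i1 hK.
    rewrite -(inj_eq (@inl_inj T1 T2)) -!(psumL e1 e2) -Ee eg -{2}(hK (inl y)).
    rewrite (inj_eq (bij_inj bg)) i2 -(inj_eq (bij_inj bg)) hK Er (inj_eq (@inl_inj T1 T2)).
    by rewrite -(inj_eq (bij_inj bg)) hK Ed orbF.
  move=> A Ar Av Ae x.
  pose B := [set y | if g y is inl z then z \in A else true].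
  suff /subsetP/(_ (h (inl x))) : C \subset B by rewrite Cg !inE hK; apply.
  apply: Cmin; rewrite ?inE ?Er //.
  + move=> y; rewrite !inE Hv Ev; case: (g y) => z; rewrite ?(psumL, psumR) //; exact: Av.
  + move=> y; rewrite !inE He Ee; case: (g y) => z; rewrite ?(psumL, psumR) //; exact: Ae.
- split.
    split=> y /=; first by apply: (@inr_inj T1 T2); rewrite -!(psumR e1 e2) -Ee !eg gK i1 hK.
    rewrite -(inj_eq (@inr_inj T1 T2)) -!(psumR e1 e2) -Ee eg -{2}(hK (inr y)).
    rewrite (inj_eq (bij_inj bg)) i2 -(inj_eq (bij_inj bg)) hK Er /=.
    by rewrite -(inj_eq (bij_inj bg)) hK Ed (inj_eq (@inr_inj T1 T2)).
  move=> A Ar Av Ae x.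
  have := @bridge_conn2 S iS cB [set y | if g y is inr z then z \in A else true] _ _ _ _ (h (inr x)).
  rewrite !inE Er Ed hK; apply=> //.
  + move=> y; rewrite !inE Hv Ev; case: (g y) => z; rewrite ?(psumL, psumR) //; exact: Av.
  + move=> y; rewrite !inE He Ee; case: (g y) => z; rewrite ?(psumL, psumR) //; exact: Ae.
Qed.

Lemma bridge_functor (S R : tmap) (g : S -> R) : tiso g ->
  liso (omap g : bridge S -> bridge R).
Proof.
move=> [bg vg eg rg dg]; have gI := bij_inj bg; split.
- have [h gK hK] := bg; exists (omap h).
    by case=> [x|] //=; rewrite gK.
  by case=> [x|] //=; rewrite hK.
- by move=> x; rewrite /= (ins_functor _ gI vg) rg.
- move=> x; rewrite /= !permM.
  have H y : omap g (plift (te S) y) = plift (te R) (omap g y).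
    by case: y => [y|]; rewrite ?pliftN //= !pliftS /= eg.
  by rewrite H inj_tperm /= ?dg //; exact: inj_omap.
- by rewrite /= rg.
Qed.

Lemma lmap_decomposition (M : lmap) : linv M -> lconn M -> lv M (lr M) != lr M ->
  (exists (N : lmap) x (g : M -> bridge (@amap N x)),
     [/\ liso g, linv N & lconn N]) \/
  (exists (N1 N2 : lmap) (g : M -> bridge (jmap N1 N2)),
     [/\ liso g, linv N1 /\ lconn N1 & linv N2 /\ lconn N2]).
Proof.
move=> iM cM vr; have [S [g [Ig iS]]] := bridge_onto iM vr.
have cB := liso_lconn Ig cM.
have [cS|ncS] := pselect (tconn S).
  left; have [N [x [h [Ih [iN cN]]]]] := tconn_amap iS cS.
  exists N, x, (omap h \o g); split=> //.
  exact: liso_comp Ig (bridge_functor Ih).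
right; have [N1 [N2 [h [Ih H1 H2]]]] := tconnN_jmap iS cB ncS.
exists N1, N2, (omap h \o g); split=> //.
exact: liso_comp Ig (bridge_functor Ih).
Qed.

Lemma card_bridge S : #|bridge S| = #|S|.+1.
Proof. exact: card_option. Qed.

Lemma card_amap (M : lmap) (x : M) : #|amap x| = #|M|.+1.
Proof. exact: card_option. Qed.

Lemma card_jmap M N : #|jmap M N| = #|M| + #|N|.
Proof. exact: card_sum. Qed.

Lemma lone_leg (M : lmap) : linv M -> lconn M -> lv M (lr M) = lr M ->
  forall x, x = lr M.
Proof.
move=> [_ i2] cM vr x; apply/set1P; apply: cM => [|y|y]; rewrite ?set11 //.
  by move=> /set1P ->; rewrite vr set11.
by move=> /set1P ->; rewrite inE i2.
Qed.

Lemma lone_leg_orbits (T : finType) (r : T) (s : {perm T}) :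
  (forall x, x = r) -> #|porbits s| = 1.
Proof.
move=> H; apply/eqP/cards1P; exists (porbit s r); apply/setP => A; rewrite inE.
apply/imsetP/eqP => [[x _ ->]|->]; first by rewrite (H x).
by exists r.
Qed.

(** Adding the edge keeps V + F - E if the second leg is on the root face and lowers it by 2
    otherwise. Terms are moved across to avoid subtractions. *)
Lemma amap_euler (M : lmap) (x : M) : linv M ->
  #|porbits (lv (bridge (amap x)))| + #|porbits (lf (bridge (amap x)))| +
    (le M x \notin porbit (lf M) (lr M)).*2 + #|porbits (le M)| =
  #|porbits (lv M)| + #|porbits (lf M)| + #|porbits (le (bridge (amap x)))|.
Proof.
move=> iM; have iA := amap_tinv x iM; have [cv ce cf] := amap_card x iM.
move: (bridge_F iA); rewrite (amap_same x iM).
rewrite bridge_V bridge_E cv ce cf; lia.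
Qed.

(** With legs counted as edges, planarity reads V + F - E = 1. Joining adds the two values and
    subtracts 1, so it preserves planarity. *)
Lemma jmap_euler (M N : lmap) : linv M -> linv N ->
  #|porbits (lv (bridge (jmap M N)))| + #|porbits (lf (bridge (jmap M N)))|
   + 1 + #|porbits (le M)| + #|porbits (le N)| =
  #|porbits (lv M)| + #|porbits (lf M)| + #|porbits (lv N)| + #|porbits (lf N)|
   + #|porbits (le (bridge (jmap M N)))|.
Proof.
move=> iM iN; have iA := jmap_tinv iM iN; have [cv ce cf] := jmap_card M N.
move: (bridge_F iA); rewrite (jmap_diff M N).
rewrite bridge_V bridge_E cv ce cf; lia.
Qed.

Lemma euler_inequality (M : lmap) : linv M -> lconn M ->
  #|porbits (lv M)| + #|porbits (lf M)| <= #|porbits (le M)| + 1.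
Proof.
have [n] := ubnP #|M|; elim: n M => // n IH M leM iM cM.
case: (eqVneq (lv M (lr M)) (lr M)) => [vr|vr].
  by rewrite !(@lone_leg_orbits _ (lr M)) //; exact: lone_leg.
case: (lmap_decomposition iM cM vr) => [[N [x [g [Ig iN cN]]]]|].
  have [<- <- <- cardM] := liso_card Ig.
  move: cardM; rewrite card_bridge card_amap => cardM.
  have := IH N _ iN cN; have := amap_euler x iN; lia.
move=> [N1 [N2 [g [Ig [i1 c1] [i2 c2]]]]].
have [<- <- <- cardM] := liso_card Ig.
move: cardM; rewrite card_bridge card_jmap => cardM.
have n1 : 0 < #|N1| by apply/card_gt0P; exists (lr N1).
have n2 : 0 < #|N2| by apply/card_gt0P; exists (lr N2).
have := IH N1 _ i1 c1; have := IH N2 _ i2 c2; have := jmap_euler i1 i2; lia.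
Qed.

(** * Faces of a bridge *)

Lemma last_belast_notin (T : eqType) (z : T) l :
  uniq (z :: l) -> last z l \notin belast z l.
Proof. by rewrite lastI rcons_uniq => /andP []. Qed.

(** The root face is listed as the leg, then the [k] darts to be cut off, then the darts that
    stay. *)
Lemma traject_split (T : finType) (s : {perm T}) r k : k < #|porbit s r| ->
  exists l2, [/\ fcycle s (r :: traject s (s r) k ++ l2),
    uniq (r :: traject s (s r) k ++ l2),
    porbit s r =i r :: traject s (s r) k ++ l2 &
    #|porbit s r| = (k + size l2).+1].
Proof.
move=> kN; set N := #|_| in kN *.
have [n En] : exists n, N = (k + n).+1 by exists (N - k.+1); lia.
exists (traject s (iter k.+1 s r) n).
have E : r :: traject s (s r) k ++ traject s (iter k.+1 s r) n = traject s r N.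
  by rewrite En -addSn trajectD.
rewrite E size_traject; split=> //.
- exact: fcycle_porbit.
- exact: uniq_traject_porbit.
- exact: porbit_traject.
Qed.

Section AmapFace.
Variables (M : lmap) (x : M).
Hypothesis iM : linv M.
Let r := lr M.
Let f := lf M.
Let y := le M x.
Let B := bridge (amap x).
Let f' := lf B.

Let iA : tinv (amap x) := amap_tinv x iM.

Lemma add_fN : f' None = Some (Some (f y)).
Proof. by rewrite /f' (bridge_fN iA) insS_neq // amap_f // insN. Qed.

Lemma add_fd : f' (Some None) = Some (if r == y then None else Some (f r)).
Proof. by rewrite /f' (bridge_fd iA) amap_f // insS. Qed.

Lemma add_fS z : f' (Some (Some z)) =
  if z == r then None else Some (if z == y then None else Some (f z)).
Proof.
rewrite /f' (bridge_fS iA) // amap_f // insS.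
by rewrite (inj_eq (@some_inj _)) insS.
Qed.

Lemma add_path z l : fpath f z l -> r \notin belast z l -> y \notin belast z l ->
  fpath f' (Some (Some z)) (map (fun w => Some (Some w)) l).
Proof.
elim: l z => //= a l IH z /andP [/eqP fz pl]; rewrite !inE !negb_or.
move=> /andP [rz rl] /andP [yz yl]; rewrite IH // add_fS.
by rewrite [z == r]eq_sym [z == y]eq_sym (negPf rz) (negPf yz) fz eqxx.
Qed.

(* The bridge cuts the root face [r :: l1 ++ l2] into a face [Some None :: l1]
   and the new root face [r :: None :: l2]. *)
Variables (l1 l2 : seq M).
Hypothesis (cl : fcycle f (r :: l1 ++ l2)) (ul : uniq (r :: l1 ++ l2)).
Hypothesis (ly : last r l1 = y).

Let ul_parts : [/\ r \notin l1, r \notin l2, uniq l1, uniq l2 &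
  forall z, z \in l1 -> z \notin l2].
Proof.
move: ul; rewrite /= mem_cat negb_or cat_uniq.
move=> /andP [/andP [r1 r2] /and3P [u1 /hasPn H u2]]; split=> // z z1.
by apply/negP => /H; rewrite z1.
Qed.

Lemma add_cycle_new : fcycle f' (Some None :: map (fun w => Some (Some w)) l1).
Proof.
have [r1 _ u1 _ _] := ul_parts; case El: l1 => [|a l].
  by move: ly; rewrite El /= => ry; rewrite add_fd -ry !eqxx.
move: cl ly r1 u1; rewrite El /= => /andP [/eqP fr].
rewrite rcons_cat cat_path => /andP [pl _] lay; rewrite inE negb_or.
move=> /andP [ra rl] /andP [al ul'].
have yr : r == y = false.
  rewrite -lay; apply/negP => /eqP E; have := mem_last a l.
  by rewrite -E inE (negPf ra) (negPf rl).
rewrite add_fd yr fr eqxx /= rcons_path; apply/andP; split.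
  apply: add_path => //.
    by apply/negP => /mem_belast; rewrite inE (negPf rl) (negPf ra).
  by rewrite -lay; apply: last_belast_notin => /=; rewrite al.
by rewrite last_map lay /= add_fS [y == r]eq_sym yr eqxx.
Qed.

Lemma add_cycle_root :
  fcycle f' (Some (Some r) :: None :: map (fun w => Some (Some w)) l2).
Proof.
have [r1 r2 u1 u2 u12] := ul_parts.
have pl : fpath f y (rcons l2 r).
  by move: cl; rewrite /= rcons_cat cat_path ly => /andP [].
have yl2 : y \notin l2.
  by rewrite -ly; have := mem_last r l1; rewrite inE => /predU1P [->|/u12].
rewrite /= add_fS eqxx eqxx /=.
case El: l2 pl r2 yl2 => [|a l] /=; first by move=> /andP [/eqP E _] _ _; rewrite add_fN E eqxx.
move=> /andP [/eqP E pl] r2 yl2; rewrite add_fN E eqxx /=.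
rewrite -[X in rcons _ X]/((fun w => Some (Some w)) r) -map_rcons.
by apply: add_path; rewrite ?belast_rcons.
Qed.

Let mapSS_inj : injective (fun w : M => Some (Some w)).
Proof. by move=> a b []. Qed.

Lemma porbit_add_new :
  porbit f' (Some None) =i Some None :: map (fun w => Some (Some w)) l1.
Proof.
have [r1 r2 u1 u2 u12] := ul_parts.
apply: porbit_fcycle; rewrite ?mem_head //; first exact: add_cycle_new.
by rewrite /= map_inj_uniq // u1 andbT; apply/mapP => -[].
Qed.

Lemma card_porbit_add_new : #|porbit f' (Some None)| = (size l1).+1.
Proof.
have [r1 r2 u1 u2 u12] := ul_parts.
rewrite (card_porbit_fcycle add_cycle_new) ?mem_head //= ?size_map //.
by rewrite map_inj_uniq // u1 andbT; apply/mapP => -[].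
Qed.

Let uniq_root : uniq (Some (Some r) :: None :: map (fun w => Some (Some w)) l2).
Proof.
have [r1 r2 u1 u2 u12] := ul_parts.
rewrite /= map_inj_uniq // u2 inE mem_map // negb_or r2 /= andbT.
by apply/mapP => -[].
Qed.

Lemma porbit_add_root :
  porbit f' (Some (Some r)) =i Some (Some r) :: None :: map (fun w => Some (Some w)) l2.
Proof.
by apply: porbit_fcycle; rewrite ?mem_head //; exact: add_cycle_root.
Qed.

Lemma card_porbit_add_root : #|porbit f' (Some (Some r))| = (size l2).+2.
Proof.
by rewrite (card_porbit_fcycle add_cycle_root) ?mem_head //= size_map.
Qed.

Hypothesis (rl : porbit f r =i r :: l1 ++ l2).

Lemma porbit_add_other z : z \notin porbit f r ->
  porbit f' (Some (Some z)) = (fun w => Some (Some w)) @: porbit f z.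
Proof.
move=> zr; apply: porbit_in_morph => w wz; rewrite add_fS.
have ne : w \notin porbit f r.
  by apply: contra zr; rewrite -!eq_porbit_mem => /eqP <-; rewrite eq_porbit_mem porbit_sym.
have yr : y \in porbit f r by rewrite rl -ly -cat_cons mem_cat mem_last.
rewrite ifN; last by apply: contra ne => /eqP ->; rewrite porbit_id.
by rewrite ifN //; apply: contra ne => /eqP ->.
Qed.

Lemma add_in_root z : (Some (Some z) \in porbit f' (Some (Some r))) =
  (z \in r :: l2).
Proof. by rewrite porbit_add_root !inE (inj_eq mapSS_inj) /= mem_map. Qed.

Lemma add_in_new z : (Some (Some z) \in porbit f' (Some None)) = (z \in l1).
Proof. by rewrite porbit_add_new !inE /= mem_map. Qed.

Lemma add_new_notin_root : Some None \notin porbit f' (Some (Some r)).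
Proof.
rewrite porbit_add_root !inE /=; apply/mapP => -[] //.
Qed.

End AmapFace.

Section JmapFace.
Variables (M N : lmap).
Hypothesis (iM : linv M) (iN : linv N).
Let B := bridge (jmap M N).
Let f' := lf B.
Let iJ : tinv (jmap M N) := jmap_tinv iM iN.

Lemma join_fN : f' None = Some (inr (lf N (lr N))).
Proof. by rewrite /f' (bridge_fN iJ) insS_neq // jmap_f psumR. Qed.

Lemma join_fd : f' (Some (inr (lr N))) = Some (inl (lf M (lr M))).
Proof. by rewrite /f' (bridge_fd iJ) jmap_f psumL. Qed.

Lemma join_fL z : f' (Some (inl z)) =
  if z == lr M then None else Some (inl (lf M z)).
Proof.
rewrite /f' (bridge_fS iJ) // jmap_f insS psumL.
by rewrite (inj_eq (@inl_inj _ _)).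
Qed.

Lemma join_fR z : z != lr N -> f' (Some (inr z)) = Some (inr (lf N z)).
Proof.
move=> zr; rewrite /f' (bridge_fS iJ); last by rewrite (inj_eq (@inr_inj _ _)).
by rewrite jmap_f insS_neq // psumR.
Qed.

(** The new edge has both sides on the merged face; one of them is the former leg of [N], so [None]
    is the only additional dart. *)
Lemma porbit_join_root : porbit f' (Some (inl (lr M))) =
  None |: (Some @: (inl @: porbit (lf M) (lr M) :|: inr @: porbit (lf N) (lr N))).
Proof.
set O := porbit f' _; set O1 := porbit (lf M) _; set O2 := porbit (lf N) _.
have ON : None \in O.
  by have := join_fL (lr M); rewrite eqxx => <-; rewrite mem_porbit_step porbit_id.
apply/eqP; rewrite eqEsubset; apply/andP; split.
  have SI := @some_inj (M + N)%type.
  have memL z : (Some (inl z) \in None |: (Some @: (inl @: O1 :|: inr @: O2))) = (z \in O1).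
    rewrite !inE /= (mem_imset _ _ SI) inE (mem_imset _ _ (@inl_inj M N)).
    by rewrite orbC; case: imsetP => // -[].
  have memR z : (Some (inr z) \in None |: (Some @: (inl @: O1 :|: inr @: O2))) = (z \in O2).
    rewrite !inE /= (mem_imset _ _ SI) inE (mem_imset _ _ (@inr_inj M N)).
    by case: imsetP => // -[].
  apply: porbit_closed; first by rewrite memL porbit_id.
  case=> [[z|z]|]; rewrite ?memL ?memR ?join_fN ?memR ?mem_porbit_step ?porbit_id //.
    by rewrite join_fL; case: ifP => _; rewrite ?memL ?mem_porbit_step // setU11.
  case: (eqVneq z (lr N)) => [->|zr]; rewrite ?join_fd ?join_fR //.
    by rewrite memL mem_porbit_step porbit_id.
  by rewrite memR mem_porbit_step.
have OR : O2 \subset [set z | Some (inr z) \in O].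
  rewrite /O2 -porbit_step; apply: porbit_closed.
    by rewrite inE -join_fN mem_porbit_step.
  move=> z; rewrite !inE => zO; case: (eqVneq z (lr N)) => [->|zr].
    by rewrite -join_fN mem_porbit_step.
  by rewrite -join_fR // mem_porbit_step.
have OL : O1 \subset [set z | Some (inl z) \in O].
  have H : Some (inl (lf M (lr M))) \in O.
    rewrite -join_fd mem_porbit_step.
    by move/subsetP: OR => /(_ _ (porbit_id _ _)); rewrite inE.
  apply: porbit_closed; first by rewrite inE porbit_id.
  move=> z; rewrite !inE => zO; case: (eqVneq z (lr M)) => [-> //|zr].
  by have := join_fL z; rewrite (negPf zr) => <-; rewrite mem_porbit_step.
apply/subsetP => z /setU1P [-> //|/imsetP [_ /setUP [/imsetP [w wO ->]|/imsetP [w wO ->]] ->]].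
  by move/subsetP: OL => /(_ w wO); rewrite inE.
by move/subsetP: OR => /(_ w wO); rewrite inE.
Qed.

Lemma join_in_rootL z : (Some (inl z) \in porbit f' (Some (inl (lr M)))) =
  (z \in porbit (lf M) (lr M)).
Proof.
rewrite porbit_join_root !inE /= (mem_imset _ _ (@some_inj _)) inE.
by rewrite (mem_imset _ _ (@inl_inj M N)) orbC; case: imsetP => // -[].
Qed.

Lemma join_in_rootR z : (Some (inr z) \in porbit f' (Some (inl (lr M)))) =
  (z \in porbit (lf N) (lr N)).
Proof.
rewrite porbit_join_root !inE /= (mem_imset _ _ (@some_inj _)) inE.
by rewrite (mem_imset _ _ (@inr_inj M N)); case: imsetP => // -[].
Qed.

Lemma card_porbit_join_root : #|porbit f' (Some (inl (lr M)))| =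
  (#|porbit (lf M) (lr M)| + #|porbit (lf N) (lr N)|).+1.
Proof.
rewrite porbit_join_root cardsU1 [_ \in _](introF (imsetP)) ?add1n; last by case.
rewrite card_imset; last exact: some_inj.
rewrite cardsU [X in _ - X](_ : _ = 0) ?subn0.
  by rewrite (card_imset _ (@inl_inj M N)) (card_imset _ (@inr_inj M N)).
apply/eqP; rewrite cards_eq0 -subset0; apply/subsetP => _ /setIP [/imsetP [w _ ->]].
by case/imsetP.
Qed.

Lemma porbit_join_otherL z : z \notin porbit (lf M) (lr M) ->
  porbit f' (Some (inl z)) = (fun w => Some (inl w)) @: porbit (lf M) z.
Proof.
move=> zr; apply: porbit_in_morph => w wz; rewrite join_fL ifN //.
by apply: contra zr => /eqP <-; rewrite porbit_sym.
Qed.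

Lemma porbit_join_otherR z : z \notin porbit (lf N) (lr N) ->
  porbit f' (Some (inr z)) = (fun w => Some (inr w)) @: porbit (lf N) z.
Proof.
move=> zr; apply: porbit_in_morph => w wz; rewrite join_fR //.
by apply: contra zr => /eqP <-; rewrite porbit_sym.
Qed.

End JmapFace.

(** * Marked maps and trees *)

(* [dc] tells which darts have a marked face on their right. *)
Record dmap := DMap { dm :> lmap; dc : dm -> bool }.
Arguments DMap : clear implicits.
Arguments dc : clear implicits.

Definition diso (X Y : dmap) (g : X -> Y) : Prop :=
  liso g /\ forall x, dc Y (g x) = dc X x.

Definition dgood (X : dmap) : Prop :=
  [/\ linv X, lconn X, lplanar X, forall x, dc X (lf X x) = dc X x
    & dc X (lr X) = false].

(* The leg lies on the root face, so that this is the degree plus one. *)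
Definition rootdeg (M : lmap) := #|porbit (lf M) (lr M)|.
Definition allf (P : bool -> nat -> bool) (X : dmap) : Prop :=
  forall x, x \notin porbit (lf X) (lr X) -> P (dc X x) #|porbit (lf X) x|.
Definition marks (X : dmap) := #|[set x | dc X x]|.
Definition nvert (M : lmap) := #|porbits (lv M)|.

Definition dleg : dmap := DMap (LMap unit 1%g 1%g tt) (fun _ => false).

Definition djoin (X Y : dmap) : dmap :=
  DMap (bridge (jmap X Y)) (fun z => match z with
    | Some (inl x) => dc X x | Some (inr y) => dc Y y | None => false end).

(** The darts that are cut off come from the root face and take the mark of the new face; all other
    darts of [X] keep theirs. *)
Definition dadd (X : dmap) (x : X) (b : bool) : dmap :=
  DMap (bridge (amap x)) (fun z =>
    if z \in porbit (lf (bridge (amap x))) (Some None) then b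
    else if z is Some (Some y) then dc X y else false).

Lemma dgood_root_false (X : dmap) : dgood X ->
  forall x, x \in porbit (lf X) (lr X) -> dc X x = false.
Proof. by case=> _ _ _ cf c0 x /(porbit_const cf) ->. Qed.

Lemma diso_comp (X Y Z : dmap) (g : X -> Y) (h : Y -> Z) :
  diso g -> diso h -> diso (h \o g).
Proof.
move=> [Ig cg] [Ih ch]; split; first exact: liso_comp.
by move=> x; rewrite /= ch cg.
Qed.

Lemma diso_inv (X Y : dmap) (g : X -> Y) : diso g -> exists h : Y -> X, diso h.
Proof.
move=> [/liso_inv [h [Ih gK hK]] cg]; exists h; split=> // x.
by rewrite -cg hK.
Qed.

Section DisoInvariants.
Variables (X Y : dmap) (g : X -> Y).
Hypothesis Ig : diso g.

Lemma diso_dgood : dgood X -> dgood Y.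
Proof.
case: Ig => Il cg [i c p cf c0]; split.
- exact: liso_linv Il i.
- exact: liso_lconn Il c.
- exact: liso_lplanar Il p.
- have [h [Ih gK hK]] := liso_inv Il.
  by move=> x; rewrite -(hK x) liso_f // !cg.
- by case: Il => _ _ _ <-; rewrite cg.
Qed.

Lemma diso_rootdeg : rootdeg Y = rootdeg X.
Proof.
case: Ig => Il _; rewrite /rootdeg; case: (Il) => _ _ _ <-.
by rewrite (liso_porbit Il) card_imset //; exact: liso_inj Il.
Qed.

Lemma diso_allf P : allf P X -> allf P Y.
Proof.
case: Ig => Il cg H y; have [h [Ih gK hK]] := liso_inv Il.
have gI := liso_inj Il.
rewrite -(hK y); case: (Il) => _ _ _ <-.
rewrite !(liso_porbit Il) mem_imset // card_imset // cg; exact: H.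
Qed.

Lemma diso_marks : marks Y = marks X.
Proof.
case: Ig => Il cg; have [h [Ih gK hK]] := liso_inv Il.
have gI := liso_inj Il; rewrite /marks -(card_imset _ gI); apply: eq_card => y.
by rewrite -(hK y) mem_imset // !inE cg.
Qed.

Lemma diso_nvert : nvert Y = nvert X.
Proof. by case: Ig => Il _; case: (liso_card Il). Qed.

End DisoInvariants.

Section Leg.

Lemma dleg_good : dgood dleg.
Proof.
split=> //.
- by split=> -[]; rewrite !perm1.
- by move=> A A0 _ _ [].
- by rewrite /lplanar !(@lone_leg_orbits _ tt) // => -[].
Qed.

Lemma dleg_rootdeg : rootdeg dleg = 1.
Proof.
rewrite /rootdeg -(cards1 tt); apply: eq_card => -[].
by rewrite set11 porbit_id.
Qed.

Lemma dleg_allf P : allf P dleg.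
Proof. by move=> []; rewrite porbit_id. Qed.

Lemma dleg_marks : marks dleg = 0.
Proof. by apply/eqP; rewrite cards_eq0; apply/eqP/setP => x; rewrite !inE. Qed.

Lemma dleg_nvert : nvert dleg = 1.
Proof. by rewrite /nvert (@lone_leg_orbits _ tt) // => -[]. Qed.

End Leg.

Section Join.
Variables X Y : dmap.
Hypothesis (gX : dgood X) (gY : dgood Y).
Let iX : linv X. Proof. by case: gX. Qed.
Let iY : linv Y. Proof. by case: gY. Qed.

Lemma djoin_good : dgood (djoin X Y).
Proof.
have [_ cX pX fX rX] := gX; have [_ cY pY fY rY] := gY; split.
- exact/bridge_linv/jmap_tinv.
- exact: bridge_jmap_lconn.
- by have := jmap_euler iX iY; rewrite /lplanar /= in pX pY *; lia.
- case=> [[z|z]|].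
  + rewrite join_fL //=; case: eqP => [->|_] //=; by rewrite fX.
  + case: (eqVneq z (lr Y)) => [->|zr]; first by rewrite join_fd //= fX rX rY.
    by rewrite join_fR //=.
  + by rewrite join_fN //= fY rY.
- by [].
Qed.

Lemma djoin_rootdeg : rootdeg (djoin X Y) = (rootdeg X + rootdeg Y).+1.
Proof. exact: card_porbit_join_root. Qed.

Lemma djoin_nvert : nvert (djoin X Y) = nvert X + nvert Y.
Proof. by rewrite /nvert bridge_V; case: (jmap_card X Y). Qed.

Lemma djoin_allf P : allf P (djoin X Y) <-> allf P X /\ allf P Y.
Proof.
have IL : injective (fun w : X => Some (inl w : X + Y)) by move=> a b [].
have IR : injective (fun w : Y => Some (inr w : X + Y)) by move=> a b [].
split=> [H|[HX HY]].
  split=> z zr.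
    have := H (Some (inl z)); rewrite join_in_rootL // => /(_ zr).
    by rewrite porbit_join_otherL // card_imset.
  have := H (Some (inr z)); rewrite join_in_rootR // => /(_ zr).
  by rewrite porbit_join_otherR // card_imset.
case=> [[z|z]|].
- rewrite join_in_rootL // => zr; rewrite porbit_join_otherL // card_imset //.
  exact: HX.
- rewrite join_in_rootR // => zr; rewrite porbit_join_otherR // card_imset //.
  exact: HY.
- by rewrite porbit_join_root // setU11.
Qed.

Lemma djoin_marks : marks (djoin X Y) = marks X + marks Y.
Proof.
have IL : injective (fun w : X => Some (inl w : X + Y)) by move=> a b [].
have IR : injective (fun w : Y => Some (inr w : X + Y)) by move=> a b [].
rewrite /marks -(card_imset [set x | dc X x] IL) -(card_imset [set x | dc Y x] IR).
rewrite -cardsUI [X in _ + X](_ : _ = 0) ?addn0.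
  apply: eq_card => -[[z|z]|]; rewrite !inE /=.
  + rewrite (mem_imset _ _ IL) inE orbC; case: imsetP => // -[] //.
  + rewrite (mem_imset _ _ IR) inE; case: imsetP => // -[] //.
  + by apply/esym/norP; split; apply/imsetP => -[].
apply/eqP; rewrite cards_eq0 -subset0; apply/subsetP => _ /setIP [/imsetP [w _ ->]].
by case/imsetP.
Qed.

End Join.

Section Add.
Variables (X : dmap) (x : X) (b : bool) (k : nat).
Hypothesis gX : dgood X.
Hypothesis (kr : k < rootdeg X) (ex : iter k (lf X) (lr X) = le X x).
Let iX : linv X. Proof. by case: gX. Qed.
Let r := lr X.
Let f := lf X.
Let f' := lf (bridge (amap x)).
Let Z := dadd x b.

Let ex_root : le X x \in porbit f r.
Proof. by rewrite -ex -permX mem_porbit. Qed.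

Lemma dadd_split : exists l1 l2, [/\ fcycle f (r :: l1 ++ l2),
    uniq (r :: l1 ++ l2), last r l1 = le X x, porbit f r =i r :: l1 ++ l2 &
    rootdeg X = (k + size l2).+1 /\ size l1 = k].
Proof.
have [l2 [H1 H2 H3 H4]] := traject_split kr; exists (traject f (f r) k), l2.
split=> //; last by rewrite size_traject.
by rewrite last_traject.
Qed.

Lemma dadd_in_split z : z \in porbit f r ->
  (Some (Some z) \in porbit f' (Some (Some r))) =
    (Some (Some z) \notin porbit f' (Some None)).
Proof.
have [l1 [l2 [cl ul ly rl _]]] := dadd_split.
rewrite (add_in_root iX cl ul ly) (add_in_new iX cl ul ly) rl.
move: ul; rewrite inE mem_cat inE /= mem_cat cat_uniq negb_or.
move=> /andP [/andP [r1 r2] /and3P [_ /hasPn H _]].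
case: (eqVneq z r) => [->|zr] /=; first by rewrite r1.
by case: (boolP (z \in l2)) => [/H /= -> //|_]; rewrite orbF => ->.
Qed.

Lemma dadd_None_root : None \in porbit f' (Some (Some r)).
Proof.
have [l1 [l2 [cl ul ly rl _]]] := dadd_split.
by rewrite (porbit_add_root iX cl ul ly) !inE.
Qed.

Lemma dadd_sep z : z \in porbit f' (Some (Some r)) -> z \notin porbit f' (Some None).
Proof.
have [l1 [l2 [cl ul ly rl _]]] := dadd_split => zr; apply/negP => zd.
have := add_new_notin_root iX cl ul ly; rewrite -/f' -/r porbit_sym.
move: zr zd; rewrite -!eq_porbit_mem => /eqP <- /eqP ->.
by rewrite eqxx.
Qed.

Lemma dadd_dc z : dc Z z =
  if z \in porbit f' (Some None) then b
  else if z is Some (Some y) then dc X y else false.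
Proof. by []. Qed.

Lemma dadd_other z : z \notin porbit f r ->
  porbit f' (Some (Some z)) = (fun w => Some (Some w)) @: porbit f z.
Proof.
have [l1 [l2 [cl ul ly rl _]]] := dadd_split.
exact: (porbit_add_other iX ly rl).
Qed.

Lemma dadd_other_notin z : z \notin porbit f r ->
  (Some (Some z) \notin porbit f' (Some None)) /\
  (Some (Some z) \notin porbit f' (Some (Some r))).
Proof.
move=> zr; split; rewrite porbit_sym dadd_other //; apply/imsetP => -[] // w wz [E].
by move: zr; rewrite porbit_sym E wz.
Qed.

Lemma dadd_other_dc z : z \notin porbit f r -> dc Z (Some (Some z)) = dc X z.
Proof. by case/dadd_other_notin=> H _; rewrite dadd_dc (negPf H). Qed.

Lemma dadd_good : dgood Z.
Proof.
have [_ cX pX fX rX] := gX; have rF := dgood_root_false gX.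
have Zr z : z \in porbit f' (Some (Some r)) -> dc Z z = false.
  move=> zr; rewrite dadd_dc (negPf (dadd_sep zr)); case: z zr => [[z|]|] // zr.
  case: (boolP (z \in porbit f r)) => [/rF //|/dadd_other_notin [_]].
  by rewrite zr.
split.
- exact/bridge_linv/amap_tinv.
- exact/bridge_lconn/amap_tconn/cX/amap_tinv.
- have := amap_euler x iX; rewrite ex_root /lplanar /= in pX *; lia.
- move=> z; rewrite -/f'; case: (boolP (z \in porbit f' (Some None))) => [zd|zd].
    by rewrite !dadd_dc mem_porbit_step zd.
  case: z zd => [[z|]|] zd; last by rewrite !Zr ?mem_porbit_step ?dadd_None_root.
    case: (boolP (z \in porbit f r)) => [zr|zr].
      by rewrite !Zr ?mem_porbit_step // dadd_in_split.
    have -> : f' (Some (Some z)) = Some (Some (f z)).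
      rewrite /f' add_fS // ifN; last by apply: contra zr => /eqP ->; rewrite porbit_id.
      by rewrite ifN //; apply: contra zr => /eqP ->.
    by rewrite !dadd_other_dc ?mem_porbit_step.
  by rewrite porbit_id in zd.
- by rewrite Zr ?porbit_id.
Qed.

(** The root face loses the [k] darts that are cut off and gains one side of the new edge. *)
Lemma dadd_rootdeg : rootdeg Z + k = (rootdeg X).+1.
Proof.
have [l1 [l2 [cl ul ly rl [-> _]]]] := dadd_split.
by rewrite /rootdeg (card_porbit_add_root iX cl ul ly); lia.
Qed.

Lemma dadd_nvert : nvert Z = nvert X.
Proof. by rewrite /nvert bridge_V; case: (amap_card x iX). Qed.

Lemma card_dadd_new : #|porbit f' (Some None)| = k.+1.
Proof.
have [l1 [l2 [cl ul ly rl [_ <-]]]] := dadd_split.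
by rewrite /f' (card_porbit_add_new iX cl ul ly).
Qed.

Let mapSS_inj : injective (fun w : X => Some (Some w)).
Proof. by move=> a c []. Qed.

Lemma dadd_allf (P : bool -> nat -> bool) : allf P Z <-> P b k.+1 /\ allf P X.
Proof.
split=> [H|[Pb H]].
  split; last first.
    move=> z zr; have [zn zr'] := dadd_other_notin zr.
    have := H _ zr'; rewrite dadd_other_dc //= -/f'.
    by rewrite dadd_other // card_imset.
  have := H (Some None) _; rewrite dadd_dc porbit_id.
  rewrite [X in P _ X]card_dadd_new; apply; apply/negP => /dadd_sep.
  by rewrite porbit_id.
move=> z; rewrite -/f' => zr.
case: (boolP (z \in porbit f' (Some None))) => zd.
  rewrite dadd_dc zd; move: zd; rewrite -eq_porbit_mem => /eqP ->.
  by rewrite card_dadd_new.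
case: z zr zd => [[z|]|] zr zd; last by rewrite dadd_None_root in zr.
  have zr' : z \notin porbit f r.
    by apply: contra zr => /dadd_in_split /= ->.
  by rewrite dadd_other_dc // dadd_other // card_imset //; apply: H.
by rewrite porbit_id in zd.
Qed.

Lemma dadd_marks : marks Z = (if b then k.+1 else 0) + marks X.
Proof.
have rF := dgood_root_false gX.
have -> : (if b then k.+1 else 0) = #|[set z in porbit f' (Some None) | b]|.
  case: b; rewrite ?card_dadd_new.
    by rewrite -card_dadd_new; apply: eq_card => z; rewrite inE andbT.
  by apply/esym/eqP; rewrite cards_eq0; apply/eqP/setP => z; rewrite !inE andbF.
rewrite /marks -(card_imset [set z | dc X z] mapSS_inj) -cardsUI.
rewrite [X in _ + X](_ : _ = 0) ?addn0.
  apply: eq_card => z; rewrite !inE dadd_dc; case: ifP => zd /=.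
    case: z zd => [[z|]|] zd; rewrite ?orbF //.
    - case: imsetP => [[w + [E]]|_]; rewrite ?orbF // inE => cw.
      case: (boolP (z \in porbit f r)) => [/rF|/dadd_other_notin [/negP []] //].
      by rewrite E cw.
    - by case: imsetP => [[]|_]; rewrite ?orbF.
    - by case: imsetP => [[]|_]; rewrite ?orbF.
  case: z zd => [[z|]|] zd; rewrite ?(mem_imset _ _ mapSS_inj) ?inE //.
    by case: imsetP => // -[].
  by case: imsetP => // -[].
apply/eqP; rewrite cards_eq0 -subset0; apply/subsetP => z /setIP [].
rewrite inE => /andP [+ _] /imsetP [w cw E]; rewrite E => wd.
move: cw; rewrite inE; case: (boolP (w \in porbit f r)) => [/rF -> //|].
by case/dadd_other_notin; rewrite wd.
Qed.

End Add.

(** * Trees that encode marked legged maps *)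

(* [PU k b t] cuts a face of degree [k.+1] off the root face of [t]; the
   boolean tells whether this face is marked. *)
Inductive ptree := PV | PJ of ptree & ptree | PU of nat & bool & ptree.

(** The degree of the root face, that is [rootdeg] without the leg. A join adds both sides of its
    edge; [PU k] replaces [k] sides by one. *)
Fixpoint pdeg (t : ptree) : nat :=
  match t with
  | PV => 0
  | PJ a b => (pdeg a + pdeg b).+2
  | PU k _ a => (pdeg a).+1 - k
  end.

(** The bound allows [pdeg a + 1] positions for the second leg, one for each corner of the root face
    cut at the first leg. *)
Fixpoint pwf (t : ptree) : bool :=
  match t with
  | PV => true
  | PJ a b => pwf a && pwf b
  | PU k _ a => (k <= pdeg a) && pwf a
  end.

Fixpoint pleaves (t : ptree) : nat :=
  match t with
  | PV => 1
  | PJ a b => pleaves a + pleaves b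
  | PU _ _ a => pleaves a
  end.

Fixpoint pall (P : bool -> nat -> bool) (t : ptree) : bool :=
  match t with
  | PV => true
  | PJ a b => pall P a && pall P b
  | PU k b a => P b k.+1 && pall P a
  end.

Fixpoint pmarks (t : ptree) : nat :=
  match t with
  | PV => 0
  | PJ a b => pmarks a + pmarks b
  | PU k b a => (if b then k.+1 else 0) + pmarks a
  end.

(* The second leg has to be inserted after this dart for the bridge to cut off
   the [k] darts that follow the leg along the root face. *)
Definition corner (M : lmap) (k : nat) : M := le M (iter k (lf M) (lr M)).

Fixpoint build (t : ptree) : dmap :=
  match t with
  | PV => dleg
  | PJ a b => djoin (build a) (build b)
  | PU k b a => @dadd (build a) (corner (build a) k) b
  end.

Lemma le_corner (M : lmap) k : linv M ->
  iter k (lf M) (lr M) = le M (corner M k).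
Proof. by case=> i1 _; rewrite /corner i1. Qed.

Lemma build_good t : pwf t ->
  [/\ dgood (build t), rootdeg (build t) = (pdeg t).+1,
      nvert (build t) = pleaves t & marks (build t) = pmarks t].
Proof.
elim: t => [|a IHa b IHb|k c a IHa] /=.
- split; [exact: dleg_good|exact: dleg_rootdeg|exact: dleg_nvert|exact: dleg_marks].
- move=> /andP [/IHa [ga da na ma] /IHb [gb db nb mb]]; split.
  + exact: djoin_good.
  + by rewrite djoin_rootdeg; [rewrite da db; lia|..]; case: ga; case: gb.
  + by rewrite djoin_nvert na nb.
  + by rewrite djoin_marks ma mb.
move=> /andP [kd /IHa [ga da na ma]].
have kr : k < rootdeg (build a) by rewrite da.
have ex : iter k (lf (build a)) (lr (build a)) = le (build a) (corner (build a) k).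
  by apply: le_corner; case: ga.
split.
- exact: dadd_good kr ex.
- by have /= := dadd_rootdeg c ga kr ex; rewrite da; lia.
- by rewrite dadd_nvert.
- by rewrite (dadd_marks _ ga kr ex) ma.
Qed.

Lemma build_allf P t : pwf t -> allf P (build t) <-> pall P t.
Proof.
elim: t => [|a IHa b IHb|k c a IHa] /=.
- by move=> _; split=> // _; exact: dleg_allf.
- move=> /andP [wa wb]; have [ga _ _ _] := build_good wa.
  have [gb _ _ _] := build_good wb; rewrite djoin_allf // (IHa wa) (IHb wb).
  by split=> [[-> ->]|/andP].
move=> /andP [kd wa]; have [ga da _ _] := build_good wa.
have kr : k < rootdeg (build a) by rewrite da.
have ex : iter k (lf (build a)) (lr (build a)) = le (build a) (corner (build a) k).
  by apply: le_corner; case: ga.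
rewrite (dadd_allf _ ga kr ex) (IHa wa).
by split=> [[-> ->]|/andP].
Qed.

(** * Every marked planar map comes from a tree *)

Lemma amap_functor (M N : lmap) (g : M -> N) (x : M) : liso g ->
  tiso (omap g : amap x -> amap (g x)).
Proof.
move=> [bg vg eg rg]; have gI := bij_inj bg; split=> //=.
- have [h gK hK] := bg; exists (omap h).
    by case=> [z|] //=; rewrite gK.
  by case=> [z|] //=; rewrite hK.
- exact: ins_functor.
- by case=> [z|] /=; rewrite ?pliftN // !pliftS /= eg.
- by rewrite rg.
Qed.

Lemma dadd_functor (X Y : dmap) (g : X -> Y) (x : X) b : diso g ->
  diso (omap (omap g) : @dadd X x b -> @dadd Y (g x) b).
Proof.
move=> [Ig cg]; have IB := bridge_functor (amap_functor x Ig); split=> // z.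
rewrite !dadd_dc -[Some None]/(omap (omap g) (Some None)).
rewrite (liso_porbit IB) mem_imset; last exact: liso_inj IB.
by case: ifP => // _; case: z => [[z|]|] //=.
Qed.

Definition sum_map (A B C D : Type) (g : A -> C) (h : B -> D) (z : A + B) : C + D :=
  match z with inl x => inl (g x) | inr y => inr (h y) end.

Lemma djoin_functor (X Y X' Y' : dmap) (g : X -> X') (h : Y -> Y') :
  diso g -> diso h ->
  diso (omap (sum_map g h) : djoin X Y -> djoin X' Y').
Proof.
move=> [Ig cg] [Ih ch]; have IJ : tiso (sum_map g h : jmap X Y -> jmap X' Y').
  case: Ig => [[g' gK gK'] vg eg rg]; case: Ih => [[h' hK hK'] vh eh rh].
  split=> /=; rewrite ?rg ?rh //.
  - exists (sum_map g' h'); case=> z /=; rewrite ?gK ?gK' ?hK ?hK' //.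
  - by case=> z /=; rewrite ?psumL ?psumR /= ?vg ?vh.
  - by case=> z /=; rewrite ?psumL ?psumR /= ?eg ?eh.
split; first exact: bridge_functor.
by case=> [[z|z]|] /=.
Qed.

Lemma dmap_tree (X : dmap) : dgood X ->
  exists t (g : X -> build t), pwf t /\ diso g.
Proof.
have [n] := ubnP #|X|; elim: n X => // n IH X ltX gX.
have [iX cX pX fX rX] := gX.
case: (eqVneq (lv X (lr X)) (lr X)) => [vr|vr].
  have all_r := lone_leg iX cX vr.
  exists PV, (fun _ => tt); split=> //; split; last by move=> x; rewrite (all_r x) rX.
  split=> //.
  - by exists (fun _ => lr X) => [x|[]] //; rewrite -all_r.
  - by move=> x; rewrite perm1.
  - by move=> x; rewrite perm1.
case: (lmap_decomposition iX cX vr) => [[N [x [g [Ig iN cN]]]]|].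
  have [h [Ih gK hK]] := liso_inv Ig.
  have [EV EE EF cardX] := liso_card Ig.
  move: cardX; rewrite card_bridge card_amap => cardX.
  (* [X] attains equality in Euler's inequality. Were the second leg off the root face, V + F - E
     would be larger by 2 for [N], against the inequality. *)
  have [pN exr] : lplanar N /\ le N x \in porbit (lf N) (lr N).
    have := amap_euler x iN; have := euler_inequality iN cN.
    rewrite EV EE EF; rewrite /lplanar in pX *.
    move: pX; case: (_ \in _) => /= pX H1 H2; [split=> //|exfalso]; lia.
  have [k kr ex] : exists2 k, k < rootdeg N & iter k (lf N) (lr N) = le N x.
    move: exr; rewrite porbit_traject => /trajectP [k kr ->]; by exists k.
  (* The darts of the cut face return to the root face of [N], which must be unmarked; the mark they
     had is kept in [b]. *)
  pose Y := DMap N (fun y => if y \in porbit (lf N) (lr N) then false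
    else dc X (h (Some (Some y)))).
  pose b := dc X (h (Some None)).
  have Cf z : dc X (h (lf _ z)) = dc X (h z) by rewrite -(liso_f Ih) fX.
  have Cr z : z \in porbit (lf (bridge (amap x))) (Some (Some (lr N))) ->
      dc X (h z) = false.
    move/(porbit_const (c := fun z => dc X (h z)) Cf) => ->.
    by case: Ih => _ _ _ /= ->.
  have gY : dgood Y.
    split=> //= [y|]; last by rewrite porbit_id.
    rewrite mem_porbit_step; case: ifP => // yr; rewrite -[RHS]Cf add_fS //.
    rewrite ifN; last by apply: contraFN yr => /eqP ->; rewrite porbit_id.
    by rewrite ifN //; apply: contraFN yr => /eqP ->.
  have Ig' : diso (g : X -> @dadd Y x b).
    split=> // z; rewrite -[z in RHS]gK; move: (g z) => {}z.
    rewrite dadd_dc; case: ifP => [zd|zd].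
      by rewrite (porbit_const (c := fun z => dc X (h z)) Cf zd).
    case: z zd => [[z|]|] zd /=; last by rewrite Cr // (dadd_None_root gY kr ex).
      case: ifP => // zr; rewrite Cr // (@dadd_in_split Y x k gY kr ex z zr).
      by rewrite zd.
    by rewrite porbit_id in zd.
  have [t [f [wt If]]] : exists t (g : Y -> build t), pwf t /\ diso g.
    by apply: IH => //; rewrite /Y /=; move: ltX; rewrite -cardX /=; lia.
  exists (PU k b t); have [gt dt _ _] := build_good wt.
  have Ef : f x = corner (build t) k.
    case: (If) => [[bf vf ef rf] _]; rewrite /corner -rf.
    have <- : f (iter k (lf N) (lr N)) = iter k (lf (build t)) (f (lr N)).
      elim: k {kr ex} => //= k <-.
      by rewrite -(@liso_f Y (build t) f) //; case: If.
    transitivity (f (le Y (iter k (lf N) (lr N)))); last exact: ef.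
    by rewrite /= ex; case: iN => ->.
  have IA := @dadd_functor Y _ f x b If; rewrite Ef in IA.
  exists (omap (omap f) \o g); split; last exact: diso_comp Ig' IA.
  by rewrite /= wt andbT -ltnS -dt (diso_rootdeg If).
move=> [N1 [N2 [g [Ig [i1 c1] [i2 c2]]]]].
have [h [Ih gK hK]] := liso_inv Ig.
have [EV EE EF cardX] := liso_card Ig.
move: cardX; rewrite card_bridge card_jmap => cardX.
have n1 : 0 < #|N1| by apply/card_gt0P; exists (lr N1).
have n2 : 0 < #|N2| by apply/card_gt0P; exists (lr N2).
(* The two inequalities add up to the equality for [X], so both are equalities. *)
have [p1 p2] : lplanar N1 /\ lplanar N2.
  have := jmap_euler i1 i2; have := euler_inequality i1 c1.
  have := euler_inequality i2 c2; rewrite EV EE EF; rewrite /lplanar in pX *.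
  by lia.
have Cf z : dc X (h (lf _ z)) = dc X (h z) by rewrite -(liso_f Ih) fX.
have Cr z : z \in porbit (lf (bridge (jmap N1 N2))) (Some (inl (lr N1))) ->
    dc X (h z) = false.
  move/(porbit_const (c := fun z => dc X (h z)) Cf) => ->.
  by case: Ih => _ _ _ /= ->.
pose Y1 := DMap N1 (fun y => dc X (h (Some (inl y)))).
pose Y2 := DMap N2 (fun y => dc X (h (Some (inr y)))).
have CN : dc X (h None) = false by rewrite Cr // porbit_join_root // setU11.
have r1 : dc X (h (Some (inl (lr N1)))) = false by rewrite Cr // porbit_id.
have r2 : dc X (h (Some (inr (lr N2)))) = false.
  by rewrite Cr // join_in_rootR // porbit_id.
have g1 : dgood Y1.
  split=> //= y; case: (eqVneq y (lr N1)) => [->|yr].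
    by rewrite r1 -join_fd // Cf.
  by rewrite -[RHS]Cf join_fL // (negPf yr).
have g2 : dgood Y2.
  split=> //= y; case: (eqVneq y (lr N2)) => [->|yr].
    by rewrite r2 -join_fN // Cf.
  by rewrite -[RHS]Cf join_fR.
have Ig' : diso (g : X -> djoin Y1 Y2).
  split=> // z; rewrite -[z in RHS]gK; move: (g z) => {}z.
  by case: z => [[z|z]|] /=.
have [t1 [f1 [w1 If1]]] : exists t (g : Y1 -> build t), pwf t /\ diso g.
  by apply: IH => //; rewrite /Y1 /=; move: ltX n1 n2; rewrite -cardX /=; lia.
have [t2 [f2 [w2 If2]]] : exists t (g : Y2 -> build t), pwf t /\ diso g.
  by apply: IH => //; rewrite /Y2 /=; move: ltX n1 n2; rewrite -cardX /=; lia.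
exists (PJ t1 t2), (omap (sum_map f1 f2) \o g); split; first by rewrite /= w1.
exact: diso_comp Ig' (djoin_functor If1 If2).
Qed.

(** * Uniqueness of the tree *)

Lemma omap_onto (A B : finType) (h : option A -> option B) :
  bijective h -> h None = None ->
  exists g : A -> B, bijective g /\ forall x, h (Some x) = Some (g x).
Proof.
case=> h' hK h'K hN; have h'N : h' None = None by rewrite -hN hK.
have HS x : exists y, h (Some x) = Some y.
  by case E: (h (Some x)) => [y|]; [exists y|move: (hK (Some x)); rewrite E h'N].
have HS' x : exists y, h' (Some x) = Some y.
  by case E: (h' (Some x)) => [y|]; [exists y|move: (h'K (Some x)); rewrite E hN].
have [g Hg] := @choice _ _ (fun x y => h (Some x) = Some y) HS.
have [g' Hg'] := @choice _ _ (fun x y => h' (Some x) = Some y) HS'.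
exists g; split=> //; exists g' => x; apply: (@some_inj _).
  by rewrite -Hg' -Hg hK.
by rewrite -Hg -Hg' h'K.
Qed.

(** [None] is the successor of the leg around its vertex, so an isomorphism preserves it, and with
    it the second leg, which is its reverse. *)
Lemma bridge_iso_inj (S R : tmap) (h : bridge S -> bridge R) :
  tinv S -> tinv R -> liso h ->
  exists g : S -> R, tiso g /\ forall x, h (Some x) = Some (g x).
Proof.
move=> iS iR [bh vh eh rh].
have hN : h None = None.
  by rewrite -[None](insS_eq (tv S) (tr S)) -[ins _ _ _]/(lv (bridge S) (lr (bridge S)))
    vh rh /= insS_eq.
have [g [bg Hg]] := omap_onto bh hN.
have gI := bij_inj bg; have [gv gr] := ins_iso_inj gI hN Hg vh.
have gd : g (td S) = td R.
  by apply: (@some_inj R); rewrite -Hg -(bridge_eN iS) eh hN (bridge_eN iR).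
exists g; split=> //; split=> // x; apply: (@some_inj R); rewrite -Hg.
case: (eqVneq x (td S)) => [->|xd].
  by rewrite te_d // Hg gd te_d.
by rewrite -(bridge_eS xd) eh Hg bridge_eS // -gd (inj_eq gI).
Qed.

Lemma amap_iso_inj (M N : lmap) (x : M) (y : N) (h : amap x -> amap y) :
  tiso h -> exists g : M -> N,
    [/\ liso g, forall z, h (Some z) = Some (g z) & g x = y].
Proof.
move=> [bh vh eh rh hN].
have [g [bg Hg]] := omap_onto bh hN; have gI := bij_inj bg.
have gr : g (lr M) = lr N by apply: (@some_inj N); rewrite -Hg; exact: rh.
have [gv gx] := ins_iso_inj gI hN Hg vh.
exists g; split=> //; split=> // z; apply: (@some_inj N); rewrite -Hg.
by rewrite -pliftS -[plift _ _]/(te (amap x) (Some z)) eh Hg /= pliftS.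
Qed.

(** Each summand is generated by its leg and legs go to legs in order, so the summands are
    respected. *)
Lemma jmap_iso_inj (M N M' N' : lmap) (h : jmap M N -> jmap M' N') :
  lconn M -> lconn N -> tiso h ->
  exists (g1 : M -> M') (g2 : N -> N'),
    [/\ liso g1, liso g2, forall z, h (inl z) = inl (g1 z) &
        forall z, h (inr z) = inr (g2 z)].
Proof.
move=> cM cN [bh vh eh rh dh].
have HL x : exists y, h (inl x) = inl y.
  have := cM [set x | if h (inl x) is inl _ then true else false] _ _ _ x.
  rewrite !inE => H; suff: (if h (inl x) is inl _ then true else false) = true.
    by case: (h _) => // y; exists y.
  apply: H; first by rewrite [h _]rh.
    move=> z; rewrite !inE -(psumL (lv M) (lv N)) [h (psum _ _ _)]vh.
    by case: (h _) => // w; rewrite psumL.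
  move=> z; rewrite !inE -(psumL (le M) (le N)) [h (psum _ _ _)]eh.
  by case: (h _) => // w; rewrite psumL.
have HR x : exists y, h (inr x) = inr y.
  have := cN [set x | if h (inr x) is inr _ then true else false] _ _ _ x.
  rewrite !inE => H; suff: (if h (inr x) is inr _ then true else false) = true.
    by case: (h _) => // y; exists y.
  apply: H; first by rewrite [h _]dh.
    move=> z; rewrite !inE -(psumR (lv M) (lv N)) [h (psum _ _ _)]vh.
    by case: (h _) => // w; rewrite psumR.
  move=> z; rewrite !inE -(psumR (le M) (le N)) [h (psum _ _ _)]eh.
  by case: (h _) => // w; rewrite psumR.
have [g1 H1] := @choice _ _ (fun x y => h (inl x) = inl y) HL.
have [g2 H2] := @choice _ _ (fun x y => h (inr x) = inr y) HR.
have hI := bij_inj bh; have [h' hK h'K] := bh.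
exists g1, g2; split=> //.
  split.
  - exists (fun y => if h' (inl y) is inl x then x else lr M) => x.
      by rewrite -H1 hK.
    case E: (h' (inl x)) => [y|y]; have := h'K (inl x); rewrite E ?H1 ?H2 //.
    by case.
  - move=> x; apply: (@inl_inj M' N'); rewrite -H1 -(psumL (lv M) (lv N)).
    by rewrite -(psumL (lv M') (lv N')) -H1; exact: vh.
  - move=> x; apply: (@inl_inj M' N'); rewrite -H1 -(psumL (le M) (le N)).
    by rewrite -(psumL (le M') (le N')) -H1; exact: eh.
  - by apply: (@inl_inj M' N'); rewrite -H1; exact: rh.
split.
- exists (fun y => if h' (inr y) is inr x then x else lr N) => x.
    by rewrite -H2 hK.
  case E: (h' (inr x)) => [y|y]; have := h'K (inr x); rewrite E ?H1 ?H2 //.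
  by case.
- move=> x; apply: (@inr_inj M' N'); rewrite -H2 -(psumR (lv M) (lv N)).
  by rewrite -(psumR (lv M') (lv N')) -H2; exact: vh.
- move=> x; apply: (@inr_inj M' N'); rewrite -H2 -(psumR (le M) (le N)).
  by rewrite -(psumR (le M') (le N')) -H2; exact: eh.
- by apply: (@inr_inj M' N'); rewrite -H2; exact: dh.
Qed.

Lemma liso_lone (M N : lmap) (g : M -> N) : liso g ->
  (lv N (lr N) == lr N) = (lv M (lr M) == lr M).
Proof. by move=> Ig; case: (Ig) => _ vg _ <-; rewrite -vg (inj_eq (liso_inj Ig)). Qed.

Lemma bridge_lone (S : tmap) : (lv (bridge S) (lr (bridge S)) == lr (bridge S)) = false.
Proof. by rewrite /= insS_eq. Qed.

Lemma bridge_amap_jmap (M N1 N2 : lmap) (x : M) (h : bridge (amap x) -> bridge (jmap N1 N2)) :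
  linv M -> lconn M -> linv N1 -> linv N2 -> liso h -> False.
Proof.
move=> iM cM i1 i2 Ih.
have [g [Ig _]] := bridge_iso_inj (amap_tinv x iM) (jmap_tinv i1 i2) Ih.
by apply: (@jmap_tconnN N1 N2); apply: (tiso_tconn Ig); exact: amap_tconn.
Qed.

(** The shape of the root is an invariant of the map: a leg alone at its vertex, or else a root edge
    whose deletion disconnects or not. *)
Lemma build_inj t t' (h : build t -> build t') : pwf t -> pwf t' -> diso h -> t = t'.
Proof.
elim: t t' h => [|a IHa b IHb|k c a IHa] [|a' b'|k' c' a'] h //= w w' Ih.
- by have := liso_lone Ih.1; rewrite bridge_lone /= perm1.
- by have := liso_lone Ih.1; rewrite bridge_lone /= perm1.
- by have := liso_lone Ih.1; rewrite bridge_lone /= perm1.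
- case/andP: w => wa wb; case/andP: w' => wa' wb'.
  have [[ia ca _ _ _] _ _ _] := build_good wa.
  have [[ib cb _ _ _] _ _ _] := build_good wb.
  have [[ia' _ _ _ _] _ _ _] := build_good wa'.
  have [[ib' _ _ _ _] _ _ _] := build_good wb'.
  have [g [Ig Hg]] := bridge_iso_inj (jmap_tinv ia ib) (jmap_tinv ia' ib') Ih.1.
  have [g1 [g2 [I1 I2 H1 H2]]] := jmap_iso_inj ca cb Ig.
  rewrite (IHa a' g1) //; last first.
    by split=> // x; have := Ih.2 (Some (inl x)); rewrite Hg H1.
  rewrite (IHb b' g2) //.
  by split=> // x; have := Ih.2 (Some (inr x)); rewrite Hg H2.
- case/andP: w => wa wb; case/andP: w' => kd' wa'.
  have [[ia ca _ _ _] _ _ _] := build_good wa.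
  have [[ib cb _ _ _] _ _ _] := build_good wb.
  have [[ia' ca' _ _ _] _ _ _] := build_good wa'.
  have [h' [Ih' _ _]] := liso_inv Ih.1.
  by case: (bridge_amap_jmap ia' ca' ia ib Ih').
- by have := liso_lone Ih.1; rewrite bridge_lone /= perm1.
- case/andP: w => kd wa; case/andP: w' => wa' wb'.
  have [[ia ca _ _ _] _ _ _] := build_good wa.
  have [[ia' _ _ _ _] _ _ _] := build_good wa'.
  have [[ib' _ _ _ _] _ _ _] := build_good wb'.
  by case: (bridge_amap_jmap ia ca ia' ib' Ih.1).
case/andP: w => kd wa; case/andP: w' => kd' wa'.
have [ga da _ _] := build_good wa; have [ga' da' _ _] := build_good wa'.
have ia : linv (build a) by case: ga.
have ia' : linv (build a') by case: ga'.
have [g [Ig Hg]] := bridge_iso_inj (amap_tinv _ ia) (amap_tinv _ ia') Ih.1.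
have [f [If Hf Ef]] := amap_iso_inj Ig.
have kr : k < rootdeg (build a) by rewrite da.
have kr' : k' < rootdeg (build a') by rewrite da'.
have ek := le_corner k ia; have ek' := le_corner k' ia'.
have Id : diso (f : build a -> build a').
  split=> // x; have := Ih.2 (Some (Some x)); rewrite Hg Hf.
  have ff := liso_f If; have fr : f (lr (build a)) = lr (build a') by case: If.
  case: (boolP (x \in porbit (lf (build a)) (lr (build a)))) => xr.
    have xr' : f x \in porbit (lf (build a')) (lr (build a')).
      by rewrite -fr (liso_porbit If) imset_f.
    by rewrite (dgood_root_false ga xr) (dgood_root_false ga' xr').
  rewrite (dadd_other_dc _ ga kr ek) // (dadd_other_dc _ ga' kr' ek') //.
  by rewrite -fr (liso_porbit If) mem_imset //; exact: liso_inj If.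
have Ea := IHa _ f wa wa' Id; subst a'.
have Ec : c = c'.
  have := Ih.2 (Some None); rewrite Hg [g None](_ : _ = None); last by case: Ig.
  by rewrite !dadd_dc !porbit_id.
(* Once the two subtrees are equal, [f] is an automorphism fixing the leg, hence fixing every dart
   of the root face; so it cannot move the second leg along it. *)
have Ek : k = k'.
  have fit j : f (iter j (lf (build a)) (lr (build a))) =
               iter j (lf (build a)) (lr (build a)).
    elim: j => [|j IHj] /=; first by case: If.
    by rewrite -(liso_f If) IHj.
  have Ekk : iter k (lf (build a)) (lr (build a)) = iter k' (lf (build a)) (lr (build a)).
    rewrite -fit; apply: (@perm_inj _ (le (build a))); rewrite -[RHS]Ef.
    by case: If => _ _ <- _.
  have U := uniq_traject_porbit (lf (build a)) (lr (build a)).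
  apply/eqP; rewrite -(nth_uniq (lr (build a)) _ _ U) ?size_traject //.
  by rewrite !nth_traject // Ekk.
by rewrite Ec Ek.
Qed.

(** * Rooted maps as legged maps *)

From mathcomp Require Import finmap classical_sets functions cardinality.

(** Infinite sets have [ncard] 0, so the equality also covers them, and classes of maps can be
    traded for trees before finiteness is established. *)
Lemma ncard_bij (T U : choiceType) (A : set T) (B : set U) (g : T -> U) :
  set_bij A B g -> ncard A = ncard B.
Proof.
move=> gb; rewrite /ncard; have AB : (A #= B)%card := pcard_eq (bij_of_set_bijection gb).
have [fA|iA] := pselect (finite_set A).
  have fB : finite_set B by rewrite -(eq_finite_set AB).
  have [n An] := (finite_setP A).1 fA.
  rewrite (card_fset_set An); have Bn : (B #= `I_n)%card by rewrite -(card_eql AB).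
  by rewrite (card_fset_set Bn).
have iB : ~ finite_set B by rewrite -(eq_finite_set AB).
by rewrite /fset_set; case: pselect => // _; case: pselect => // _; rewrite !cardfs0.
Qed.

Lemma ncard_seq (T : choiceType) (A : set T) (s : seq T) :
  uniq s -> (forall x, A x <-> x \in s) -> ncard A = size s.
Proof.
move=> us As; have EA : A = [set` [fset x in s]%fset]%classic.
  by apply/seteqP; split=> x; rewrite /= inE => /As.
by rewrite /ncard EA set_fsetK card_fseq undup_id.
Qed.

HB.instance Definition _ := gen_eqMixin ptree.
HB.instance Definition _ := gen_choiceMixin ptree.

(* The leg is inserted in the corner that precedes the root dart. *)
Definition leg (m : rmap) : lmap :=
  LMap (option 'I_(ndart m)) (ins (vperm m) ((vperm m)^-1 (Defs.root m))%g)
    (plift (eperm m)) None.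

Definition dleg_of (x : fmap) : dmap :=
  DMap (leg (base x)) (fun z => if z is Some d then d \in mface x else false).

Section LegOfMap.
Variable m : rmap.
Let e := eperm m.
Let v := vperm m.
Let f := face_perm m.
Let n := ndart m.

(** The dart that precedes the root dart along the root face; the leg comes between them. *)
Definition last_dart : 'I_n := (e^-1 (v^-1 (Defs.root m)))%g.

Lemma leg_lf : lf (leg m) = ins f last_dart.
Proof. exact: plift_mul_ins. Qed.

Lemma porbit_last_dart : porbit f last_dart = root_face m.
Proof.
by rewrite -porbit_step /f /face_perm permM /last_dart !permKV.
Qed.

Lemma porbit_leg_root : porbit (lf (leg m)) None = None |: Some @: root_face m.
Proof. by rewrite leg_lf porbit_insN porbit_last_dart. Qed.

Lemma leg_in_root d : (Some d \in porbit (lf (leg m)) None) = (d \in root_face m).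
Proof. by rewrite porbit_leg_root !inE /= (mem_imset _ _ (@some_inj _)). Qed.

Lemma porbit_leg_other d : d \notin root_face m ->
  porbit (lf (leg m)) (Some d) = Some @: porbit f d.
Proof.
move=> dr; have nd : last_dart \notin porbit f d.
  by rewrite porbit_sym porbit_last_dart.
by rewrite leg_lf porbit_insS (negPf nd) finset.setU0.
Qed.

Lemma leg_rootdeg : rootdeg (leg m) = #|root_face m|.+1.
Proof.
rewrite /rootdeg porbit_leg_root cardsU1 card_imset; last exact: some_inj.
by case: imsetP => [[]|].
Qed.

Lemma leg_nvert : nvert (leg m) = #|vertices m|.
Proof. exact: card_porbits_ins. Qed.

(** The leg enters an existing vertex and an existing face and only adds an orbit of edges, whence
    the constants 1 and 2. *)
Lemma leg_lplanar : lplanar (leg m) <-> #|vertices m| + #|faces m| = #|edges m| + 2.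
Proof.
rewrite /lplanar leg_lf !card_porbits_ins card_porbits_plift /vertices /faces /edges.
by rewrite addn1 addn2.
Qed.

Lemma leg_linv : linv (leg m) <->
  (forall d, e d != d) /\ (forall d, e (e d) = d).
Proof.
split=> [[i1 i2]|[i1 i2]].
  split=> d; last by apply: (@some_inj 'I_n); rewrite -[RHS]i1 /= !pliftS.
  by have := i2 (Some d); rewrite /= pliftS (inj_eq (@some_inj _)) => ->.
split=> -[d|]; rewrite /= ?pliftS ?pliftN ?i2 //.
by rewrite (inj_eq (@some_inj _)) (negPf (i1 d)).
Qed.

Lemma connect_closed (A : {set 'I_n}) d d' :
  d \in A -> {in A, forall x, v x \in A} -> {in A, forall x, e x \in A} ->
  connect (dart_step (m := m)) d d' -> d' \in A.
Proof.
move=> + Av Ae /connectP [p + ->]; elim: p d => //= a p IH d dA /andP [da pp].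
by apply: IH => //; case/orP: da => /eqP ->; [exact: Av|exact: Ae].
Qed.

Lemma connect_v d d' : connect (dart_step (m := m)) d d' ->
  connect (dart_step (m := m)) d (v d').
Proof. by move/connect_trans; apply; apply: connect1; rewrite /dart_step eqxx. Qed.

Lemma connect_e d d' : connect (dart_step (m := m)) d d' ->
  connect (dart_step (m := m)) d (e d').
Proof. by move/connect_trans; apply; apply: connect1; rewrite /dart_step eqxx orbT. Qed.

Lemma leg_lconn : lconn (leg m) <->
  forall d d', connect (dart_step (m := m)) d d'.
Proof.
set step := dart_step (m := m).
split=> [cM d d'|cm A Ar Av Ae].
  have reach x : connect step (Defs.root m) x.
    have := cM [set z | if z is Some y then connect step (Defs.root m) y else true] _ _ _ (Some x).
    rewrite !inE; apply=> //.
      move=> [y|]; rewrite !inE /= ?insN ?permKV ?connect0 // insS.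
      by case: ifP => // _; exact: connect_v.
    by move=> [y|]; rewrite !inE /= ?pliftN // pliftS; exact: connect_e.
  (* Steps are oriented. That [d] reaches the root follows from the closedness of the complement of
     what [d] reaches, which would otherwise contain the root and so [d]. *)
  suff dr : connect step d (Defs.root m) by apply: connect_trans dr (reach _).
  pose A := [set x | connect step d x].
  have Av : {in A, forall x, v x \in A} by move=> x; rewrite !inE; exact: connect_v.
  have Ae : {in A, forall x, e x \in A} by move=> x; rewrite !inE; exact: connect_e.
  have : Defs.root m \notin ~: A.
    apply/negP => rA; have := @connect_closed (~: A) (Defs.root m) d rA.
    move/(_ (perm_closed_setC Av) (perm_closed_setC Ae) (reach d)).
    by rewrite !inE connect0.
  by rewrite !inE negbK.
have {}Av : {in A, forall z, ins v (v^-1 (Defs.root m))%g z \in A} by [].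
have {}Ae : {in A, forall z, plift e z \in A} by [].
have rA : Some (Defs.root m) \in A by have := Av _ Ar; rewrite insN permKV.
case=> [x|] //.
suff : x \in [set y | Some y \in A] by rewrite inE.
apply: (@connect_closed _ (Defs.root m)); rewrite ?inE //.
  move=> y; rewrite !inE => yA; case: (eqVneq y (v^-1 (Defs.root m))%g) => [->|yr].
    by rewrite permKV.
  by rewrite -(insS_neq _ yr) Av.
by move=> y; rewrite !inE => yA; rewrite -pliftS Ae.
Qed.

End LegOfMap.

Lemma dleg_of_iso (x y : fmap) : fmap_iso x y <->
  exists g : dleg_of x -> dleg_of y, diso g.
Proof.
split.
  case=> f [bf vf ef rf] cf; have fI := bij_inj bf; have [f' fK fK'] := bf.
  have rr : f ((vperm (base x))^-1 (Defs.root (base x)))%g =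
            ((vperm (base y))^-1 (Defs.root (base y)))%g.
    by apply: (@perm_inj _ (vperm (base y))); rewrite -vf !permKV.
  exists (omap f); split; last first.
    by case=> [d|] //=; rewrite -cf mem_imset.
  split=> //.
  - exists (omap f'); first by case=> [d|] //=; rewrite fK.
    by case=> [d|] //=; rewrite fK'.
  - by move=> z; rewrite /= (ins_functor _ fI vf) rr.
  - by case=> [d|] /=; rewrite ?pliftN // !pliftS /= ef.
case=> h [[bh vh eh hN] ch]; have [g [bg Hg]] := omap_onto bh hN.
have gI := bij_inj bg; have [gv gr] := ins_iso_inj gI hN Hg vh.
have cg d : (g d \in mface y) = (d \in mface x).
  by have := ch (Some d); rewrite Hg.
exists g; last first.
  have [g' gK gK'] := bg; apply/setP => d; rewrite -(gK' d) cg mem_imset //.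
split=> //.
  by move=> d; have := eh (Some d); rewrite /= Hg !pliftS Hg => -[].
by rewrite -[Defs.root (base x)](permKV (vperm (base x))) gv gr permKV.
Qed.

Lemma dleg_of_onto (X : dmap) : dgood X -> lv X (lr X) != lr X ->
  exists x (g : X -> dleg_of x), diso g.
Proof.
move=> [[i1 i2] _ _ _ cr] vr.
have [T [g0 [bg0 g0r]]] := point_split (lr X).
(* The darts of an [rmap] are ordinals, so those other than the leg are numbered. *)
pose g z : option 'I_#|T| := omap enum_rank (g0 z).
have bg : bijective g.
  have [h0 g0K h0K] := bg0; exists (fun z => h0 (omap enum_val z)) => z.
    by rewrite /g; case: (g0 z) (g0K z) => [y|] /= <- //; rewrite enum_rankK.
  by rewrite /g h0K; case: z => [z|] //=; rewrite enum_valK.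
have gr : g (lr X) = None by rewrite /g g0r.
have [v Hv] := transport_perm (lv X) bg.
have [e He] := transport_perm (le X) bg.
have gI := bij_inj bg; have [h gK hK] := bg.
have vN : v None != None by rewrite -gr -Hv (inj_eq gI).
have [v' [a Ev]] := ins_onto vN.
have [|e' Ee] := @plift_onto _ e.
  by rewrite -gr -He; congr g; apply/eqP; rewrite i2.
pose m := RMap v' e' (v' a).
exists (@FMap m [set d | dc X (h (Some d))]), g; split; last first.
  move=> z; rewrite -[z in RHS]gK; case: (g z) => [d|] /=; first by rewrite inE.
  by rewrite -gr gK cr.
split=> //= z; first by rewrite Hv Ev permK.
by rewrite He Ee.
Qed.

(** Existence and uniqueness of the tree, turned into a bijection between trees and isomorphism
    classes; stated once for maps with and without a marked face. *)
Lemma ncard_classes_ptree (U : Type) (D : U -> dmap) (eqv : U -> U -> Prop)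
    (Q : U -> Prop) (Tr : ptree -> Prop) :
  (forall u, Q u -> dgood (D u)) ->
  (forall u w, Q u -> eqv u w <-> exists g : D u -> D w, diso g) ->
  (forall u t (g : D u -> build t), pwf t -> diso g -> Q u <-> Tr t) ->
  (forall t, Tr t -> pwf t) ->
  (forall t, Tr t -> exists u (g : D u -> build t), diso g) ->
  ncard (Defs.classes eqv Q) = ncard (Tr : set ptree).
Proof.
move=> Qg Qe QT Tw Ts; apply/esym.
pose F (t : ptree) : set U := (fun u => exists g : D u -> build t, diso g).
have FE u t (g : D u -> build t) : Q u -> diso g -> F t = (fun w => eqv u w).
  move=> Qu Ig; apply/seteqP; split=> w.
    case=> h Ih; apply/Qe => //; have [h' Ih'] := diso_inv Ih.
    by exists (h' \o g); exact: diso_comp Ig Ih'.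
  move/(Qe _ _ Qu) => [h Ih]; have [h' Ih'] := diso_inv Ih.
  by exists (g \o h'); exact: diso_comp Ih' Ig.
apply: (@ncard_bij _ _ _ _ F); split.
- move=> t Tt; have [u [g Ig]] := Ts t Tt; have Qu := (QT u t g (Tw t Tt) Ig).2 Tt.
  by exists u => //; rewrite (FE u t g).
- move=> t t'; rewrite !inE => Tt Tt' E; have [u [g Ig]] := Ts t Tt.
  have [g' Ig'] : F t' u by rewrite -E; exists g.
  have [h Ih] := diso_inv Ig.
  by apply: (@build_inj t t' (g' \o h)); [exact: Tw|exact: Tw|exact: diso_comp Ih Ig'].
- move=> _ [u Qu <-]; have [t [g [wt Ig]]] := dmap_tree (Qg u Qu).
  by exists t; [apply/(QT u t g wt Ig)|rewrite (FE u t g)].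
Qed.

Definition ptrees (P : bool -> nat -> bool) (n p k : nat) (t : ptree) : Prop :=
  [/\ pwf t, pdeg t = p.*2, pleaves t = n, pall P t & pmarks t = k].

Lemma dmap_ptrees (X : dmap) t (g : X -> build t) P n p k : pwf t -> diso g ->
  [/\ rootdeg X = p.*2.+1, nvert X = n, allf P X & marks X = k] <->
  ptrees P n p k t.
Proof.
move=> wt Ig; have [_ E1 E2 E3] := build_good wt; have [h Ih] := diso_inv Ig.
have E4 := diso_rootdeg Ig; rewrite E1 in E4.
split=> [[]|[_]]; rewrite -E4 -?(diso_nvert Ig) -?(diso_marks Ig) E2 E3.
  move=> [] dt nt /(diso_allf Ig)/(build_allf P wt) Pt mt; by split.
move=> -> nt /(build_allf P wt)/(diso_allf Ih) Pt mt; by split.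
Qed.

Lemma ptrees_realize P n p k t : 0 < p -> ptrees P n p k t ->
  exists x (g : dleg_of x -> build t), diso g.
Proof.
move=> p0 [wt dt _ _ _]; have [gt rt _ _] := build_good wt.
have [|x [g Ig]] := dleg_of_onto gt.
  by case: t {wt gt rt} dt => [|a b|j b a] dt; rewrite ?bridge_lone //= in dt *; lia.
by have [h Ih] := diso_inv Ig; exists x, h.
Qed.

Lemma planar_leg (m : rmap) : planar_map m <->
  [/\ linv (leg m), lconn (leg m) & lplanar (leg m)].
Proof.
split=> [[e1 e2 c p]|[/leg_linv [e1 e2] /leg_lconn c /leg_lplanar p]]; last by split.
by split; [apply/leg_linv|apply/leg_lconn|apply/leg_lplanar].
Qed.

Definition quad_ok (b : bool) (j : nat) : bool := ~~ b && (j == 4).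
(** Alone this allows several marked faces; requiring [q.*2] darts on marked faces, with [q > 0],
    leaves exactly one. *)
Definition quad_mark_ok (q : nat) (b : bool) (j : nat) : bool :=
  j == (if b then q.*2 else 4).

Lemma quad_boundary_leg n p m :
  let X := dleg_of (@FMap m finset.set0) in
  is_quad_boundary n p m <->
  dgood X /\ [/\ rootdeg X = p.*2.+1, nvert X = n, allf quad_ok X & marks X = 0].
Proof.
move=> X; have c0 z : dc X z = false by case: z => [z|] //=; rewrite inE.
rewrite /dgood [rootdeg X]leg_rootdeg [nvert X]leg_nvert; split.
  case=> /planar_leg [iM cM pM] -> -> H; split; split=> //.
  + by move=> z; rewrite !c0.
  + case=> [d|]; last by rewrite porbit_id.
    rewrite [_ \in _]leg_in_root => dr; rewrite c0 porbit_leg_other // /quad_ok.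
    rewrite card_imset; last exact: some_inj.
    rewrite H ?imset_f //.
    by apply: contra dr => /eqP <-; rewrite porbit_id.
  + by apply/eqP; rewrite cards_eq0; apply/eqP/setP => z; rewrite !inE c0.
case=> -[iM cM pM _ _] [[Er] En H _]; split=> //; first exact/planar_leg.
move=> _ /imsetP [d _ ->] dr.
have dr' : d \notin root_face m by apply: contra dr; rewrite -eq_porbit_mem.
have := H (Some d); rewrite [_ \in _]leg_in_root => /(_ dr').
rewrite c0 porbit_leg_other // card_imset; last exact: some_inj.
by move=> /eqP.
Qed.

Lemma quad_boundary_face_leg n p q x : 0 < q ->
  let X := dleg_of x in
  is_quad_boundary_face n p q x <->
  dgood X /\ [/\ rootdeg X = p.*2.+1, nvert X = n, allf (quad_mark_ok q) X
    & marks X = q.*2].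
Proof.
move=> q0 X; have mX : marks X = #|mface x|.
  rewrite /marks -[RHS](card_imset _ (@some_inj _)); apply: eq_card => -[d|].
    by rewrite (mem_imset _ _ (@some_inj _)) inE.
  by rewrite inE; case: imsetP => // -[].
set m := base x in X mX *; set f := face_perm m.
rewrite /dgood [rootdeg X]leg_rootdeg [nvert X]leg_nvert mX; split.
  case=> /planar_leg [iM cM pM] -> -> [/imsetP [d0 _ Em] mr Eq] H.
  have mf d : (f d \in mface x) = (d \in mface x) by rewrite Em mem_porbit_step.
  have rm d : d \in root_face m -> d \in mface x = false.
    move=> dr; apply/negbTE; apply: contra mr; rewrite Em /root_face => dm.
    by move: dr dm; rewrite -!eq_porbit_mem => /eqP <- /eqP <-.
  split; split=> //.
  + case=> [d|] /=; last first.
      rewrite [lf _]leg_lf insN rm // -porbit_last_dart mem_porbit_step.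
      exact: porbit_id.
    rewrite [lf _]leg_lf insS; case: ifP => [/eqP ->|_]; last exact: mf.
    by rewrite rm // -porbit_last_dart porbit_id.
  + case=> [d|]; last by rewrite porbit_id.
    rewrite [_ \in _]leg_in_root => dr; rewrite porbit_leg_other //= /quad_mark_ok.
    rewrite card_imset; last exact: some_inj.
    case: ifP => dm.
      by move: dm; rewrite Em -eq_porbit_mem => /eqP ->; rewrite -[porbit _ _]Em Eq.
    apply/eqP; apply: H; first exact: imset_f.
      by apply: contra dr => /eqP <-; rewrite porbit_id.
    by apply: contraFN dm => /eqP <-; rewrite porbit_id.
case=> -[iM cM pM fX rX] [[Er] En H Em].
have m0 : (last_dart m \in mface x) = false.
  by have := fX (Some (last_dart m)); rewrite [lf _]leg_lf insS_eq.
have m1 : (f (last_dart m) \in mface x) = false.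
  by have := fX None; rewrite [lf _]leg_lf insN.
have mf d : (f d \in mface x) = (d \in mface x).
  case: (eqVneq d (last_dart m)) => [->|dl]; first by rewrite m0 m1.
  by have := fX (Some d); rewrite [lf _]leg_lf insS_neq.
have mr d : d \in mface x -> d \notin root_face m.
  move=> dm; apply/negP; rewrite -porbit_last_dart.
  by move/(porbit_const (c := fun z => z \in mface x) mf); rewrite dm m0.
have Hm d : d \notin root_face m ->
    #|porbit f d| = if d \in mface x then q.*2 else 4.
  move=> dr; have := H (Some d); rewrite [_ \in _]leg_in_root => /(_ dr).
  rewrite porbit_leg_other // card_imset; last exact: some_inj.
  by move=> /eqP.
have [d0 d0m] : exists d0, d0 \in mface x.
  by apply/card_gt0P; rewrite Em double_gt0.
(* The face of a marked dart is contained in [mface x] and already has its cardinality. *)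
have EF : mface x = porbit f d0.
  apply/esym/eqP; rewrite eqEcard Em Hm ?mr // d0m leqnn andbT.
  by apply: porbit_closed => // d; rewrite mf.
split=> //.
- exact/planar_leg.
- split=> //; first by rewrite EF imset_f.
  by apply: contra (mr d0 d0m) => /eqP <-.
move=> _ /imsetP [d _ ->] dr dm.
have dr' : d \notin root_face m by apply: contra dr; rewrite -eq_porbit_mem.
by rewrite Hm // ifN //; apply: contra dm; rewrite EF -eq_porbit_mem.
Qed.

Lemma numQ_ptrees n p : 0 < p -> numQ n p = ncard (ptrees quad_ok n p 0 : set ptree).
Proof.
case: p => // p _; rewrite /numQ.
apply: (@ncard_classes_ptree _ (fun m => dleg_of (@FMap m finset.set0))).
- by move=> m /quad_boundary_leg [].
- move=> m m' _; rewrite -dleg_of_iso.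
  by split=> [[g Ig]|[g Ig _]]; exists g => //=; rewrite imset0.
- move=> m t g wt Ig; rewrite quad_boundary_leg -(dmap_ptrees _ _ _ _ wt Ig).
  have gX : dgood (dleg_of (@FMap m finset.set0)).
    have [h Ih] := diso_inv Ig; apply: diso_dgood Ih _.
    by have [] := build_good wt.
  by split=> [[]|].
- by move=> t [].
move=> t Tt; have [x [g Ig]] := ptrees_realize (ltn0Sn p) Tt.
have [wt _ _ _ mt] := Tt; have [_ _ _ Em] := build_good wt.
have c0 z : dc (dleg_of x) z = false.
  have := diso_marks Ig; rewrite Em mt => /esym /eqP.
  by rewrite cards_eq0 => /eqP /setP /(_ z); rewrite !inE.
exists (base x).
have [h Ih] : exists h : dleg_of (@FMap (base x) finset.set0) -> dleg_of x, diso h.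
  exists id; split; first exact: liso_id.
  by move=> z; rewrite c0; case: z => [z|] //=; rewrite inE.
by exists (g \o h); exact: diso_comp Ih Ig.
Qed.

Lemma numQ2_ptrees n p q : 0 < p -> 0 < q ->
  numQ2 n p q = ncard (ptrees (quad_mark_ok q) n p q.*2 : set ptree).
Proof.
move=> p0 q0; apply: (@ncard_classes_ptree _ dleg_of).
- by move=> x /(quad_boundary_face_leg n p x q0) [].
- by move=> x y _; rewrite dleg_of_iso.
- move=> x t g wt Ig.
  rewrite (quad_boundary_face_leg n p x q0) -(dmap_ptrees _ _ _ _ wt Ig).
  have gX : dgood (dleg_of x).
    have [h Ih] := diso_inv Ig; apply: diso_dgood Ih _.
    by have [] := build_good wt.
  by split=> [[]|].
- by move=> t [].
by move=> t; exact: ptrees_realize.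
Qed.

(** * Counting labelled trees *)

Lemma finite_set_uniq_seq (T : choiceType) (A : set T) : finite_set A ->
  exists s : seq T, uniq s /\ forall x, A x <-> x \in s.
Proof.
move=> fA; exists (fset_set A); split=> [|x]; first exact: fset_uniq.
by rewrite in_fset_set // inE.
Qed.

Lemma ncard0 (T : choiceType) (A : set T) : (forall x, ~ A x) -> ncard A = 0.
Proof. by move=> H; rewrite (@ncard_seq _ _ [::]) // => x; split=> // /H. Qed.

Lemma ncardU (T : choiceType) (A B : set T) : finite_set A -> finite_set B ->
  (forall x, A x -> ~ B x) -> ncard (A `|` B)%classic = ncard A + ncard B.
Proof.
move=> /finite_set_uniq_seq [s [us As]] /finite_set_uniq_seq [s' [us' Bs]] AB.
rewrite (ncard_seq us As) (ncard_seq us' Bs) -size_cat; apply: ncard_seq.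
  rewrite cat_uniq us us' andbT; apply/hasPn => x /Bs Bx; apply/negP => /As Ax.
  exact: AB Ax Bx.
move=> x; rewrite mem_cat; split=> [[/As -> //|/Bs ->]|/orP [/As|/Bs]].
- by rewrite orbT.
- by left.
- by right.
Qed.

Lemma ncardX (T U : choiceType) (A : set T) (B : set U) :
  finite_set A -> finite_set B -> ncard (A `*` B)%classic = ncard A * ncard B.
Proof.
move=> /finite_set_uniq_seq [s [us As]] /finite_set_uniq_seq [s' [us' Bs]].
rewrite (ncard_seq us As) (ncard_seq us' Bs) -(size_allpairs pair).
apply: ncard_seq; first by apply: allpairs_uniq => // -[a b] [c d].
move=> [x y]; split=> [[/= /As xs /Bs ys]|/allpairsP [[a b] [/As Aa /Bs Bb [-> ->]]]].
  by apply/allpairsP; exists (x, y).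
by split.
Qed.

Lemma ncard_image (T U : choiceType) (g : T -> U) (A : set T) : injective g ->
  ncard (g @` A)%classic = ncard A.
Proof.
move=> gI; apply/esym/(ncard_bij (g := g)); split=> [x Ax|x y _ _ /gI //|//].
by exists x.
Qed.

Lemma ncard_fibers (T : choiceType) (I : eqType) (A : set T) (g : T -> I)
    (r : seq I) : finite_set A -> uniq r -> (forall x, A x -> g x \in r) ->
  ncard A = \sum_(i <- r) ncard ((fun x => A x /\ g x = i) : set T).
Proof.
move=> /finite_set_uniq_seq [s [us As]] ur Ar; rewrite (ncard_seq us As).
have E i : ncard ((fun x => A x /\ g x = i) : set T) = size [seq x <- s | g x == i].
  apply: ncard_seq; first exact: filter_uniq.
  move=> x; rewrite mem_filter; split=> [[/As -> ->]|/andP [/eqP gx /As Ax]] //.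
  by rewrite eqxx.
under eq_bigr do rewrite E size_filter -sum1_count.
rewrite (exchange_big_dep xpredT) //= -sum1_size !big_seq; apply: eq_bigr => x xs.
rewrite big_mkcond /= (bigD1_seq (g x)) //=; last by apply/Ar/As.
by rewrite eqxx big1 // => i; rewrite eq_sym => /negPf ->.
Qed.

(** One family for both kinds of trees: [b = 0] gives those counted by the [Q] and [b = 1] those
    counted by the [A]. *)
Definition ltrees (r b n p : nat) : set ltree := fun t =>
  [/\ label t = p, well_labeled r t, count_leaves true t = b &
      count_leaves false t = n].

Fixpoint height (t : ltree) : nat :=
  match t with
  | Leaf _ _ => 1
  | Unary _ a => (height a).+1
  | Binary _ a b => (maxn (height a) (height b)).+1
  end.

Fixpoint bounded_ltree (m d : nat) (t : ltree) : Prop :=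
  match d, t with
  | 0, _ => False
  | d'.+1, Leaf l _ => l <= m
  | d'.+1, Unary l a => l <= m /\ bounded_ltree m d' a
  | d'.+1, Binary l a b => [/\ l <= m, bounded_ltree m d' a & bounded_ltree m d' b]
  end.

Lemma bounded_ltree_finite m d : finite_set (bounded_ltree m d).
Proof.
elim: d => [|d IH].
  by apply: (@sub_finite_set _ _ set0) => // -[].
pose X : set ltree := bounded_ltree m d.
pose S1 := [set Leaf x.1 x.2 | x in `I_m.+1 `*` [set: bool]]%classic.
pose S2 := [set Unary x.1 x.2 | x in `I_m.+1 `*` X]%classic.
pose S3 := [set Binary x.1 x.2.1 x.2.2 | x in `I_m.+1 `*` (X `*` X)]%classic.
apply: (@sub_finite_set _ _ (S1 `|` S2 `|` S3)%classic); last first.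
  rewrite !finite_setU; split; first split; apply: finite_image; apply: finite_setX => //.
  exact: finite_setX.
move=> [l b|l a|l a b] /=.
- by move=> lm; left; left; exists (l, b).
- by move=> [lm Xa]; left; right; exists (l, a).
- by move=> [lm Xa Xb]; right; exists (l, (a, b)).
Qed.

(** Height plus label is constant along a unary vertex, and the constant 2 makes the left side
    subadditive at a binary one; [r + 3] is its value at a distinguished leaf. Height and labels are
    thus bounded by the number of leaves, which gives finiteness. *)
Lemma height_label r t : well_labeled r t ->
  height t + label t + 2 <= (r + 3) * (count_leaves true t + count_leaves false t).
Proof.
elim: t => [l b|l a IHa|l a IHa b IHb] /=.
- by case: b => ->; lia.
- by move=> [l1 la /IHa]; lia.
- by move=> [l1 lab /IHa + /IHb]; nia.
Qed.

Lemma bounded_ltreeP r m d t : well_labeled r t -> height t <= d ->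
  (r + 3) * (count_leaves true t + count_leaves false t) <= m ->
  bounded_ltree m d t.
Proof.
elim: t d => [l b|l a IHa|l a IHa b IHb] [|d] //= wl hd km.
- by have := @height_label r (Leaf l b) wl; rewrite /=; lia.
- have := @height_label r (Unary l a) wl; case: wl => _ _ wa /= H.
  by split; [lia|apply: IHa].
- have := @height_label r (Binary l a b) wl; case: wl => _ _ wa wb /= H.
  by split; [lia|apply: IHa => //; nia|apply: IHb => //; nia].
Qed.

Lemma ltrees_finite r b n p : finite_set (ltrees r b n p).
Proof.
set m := (r + 3) * (b + n).
apply: (@sub_finite_set _ _ (bounded_ltree m m)); last exact: bounded_ltree_finite.
move=> t [lt wt bt nt]; have := height_label wt; rewrite bt nt => H.
by apply: (bounded_ltreeP wt); rewrite ?bt ?nt // -/m; lia.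
Qed.

(** Label plus one is additive at a binary vertex and grows from a unary vertex to its child; it is
    [r + 1] or 1 at a leaf. *)
Lemma label_bound r t : well_labeled r t ->
  label t < r * count_leaves true t + count_leaves true t + count_leaves false t.
Proof.
elim: t => [l b|l a IHa|l a IHa b IHb] /=.
- by case: b => ->; lia.
- by move=> [l1 la /IHa]; lia.
- by move=> [l1 lab /IHa + /IHb]; nia.
Qed.

Definition nlt (r b n p : nat) : nat := ncard (ltrees r b n p).

Lemma nlt_bound r b n p : r * b + b + n <= p -> nlt r b n p = 0.
Proof.
move=> H; apply: ncard0 => t [lt wt bt nt]; have := label_bound wt.
by rewrite lt bt nt; lia.
Qed.

Lemma nlt0 r b n : 0 < r -> nlt r b n 0 = (b == 0) && (n == 1).
Proof.
move=> r0; case: andP => [[/eqP -> /eqP ->]|H].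
  apply: (@ncard_seq _ _ [:: Leaf 0 false]) => // t; rewrite inE; split.
    case: t => [l c|l a|l a c] [/= -> //].
    - by case: c => //= E; move: r0; rewrite -E.
    - by case.
    - by case.
  by move=> /eqP ->.
apply: ncard0 => -[l c|l a|l a c] [/= -> wl Eb En].
- by apply: H; case: c wl Eb En => /= E; [move: r0; rewrite -E|move=> <- <-].
- by case: wl.
- by case: wl.
Qed.

Definition lpairs (r b n p : nat) : set (ltree * ltree) := fun x =>
  [/\ label x.1 + label x.2 + 1 = p, well_labeled r x.1 /\ well_labeled r x.2,
    count_leaves true x.1 + count_leaves true x.2 = b &
    count_leaves false x.1 + count_leaves false x.2 = n].

Lemma lpairs_finite r b n p : finite_set (lpairs r b n p).
Proof.
pose m := (r + 3) * (b + n); pose X : set ltree := bounded_ltree m m.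
have fX : finite_set X := bounded_ltree_finite m m.
apply: (@sub_finite_set _ _ (X `*` X)%classic); last exact: finite_setX.
move=> [t u] [/= _ [wt wu] Eb En]; have := height_label wt; have := height_label wu.
move=> Hu Ht; split; apply: (@bounded_ltreeP r) => //=; rewrite /m; nia.
Qed.

Lemma ncard_lpairs r b n p : ncard (lpairs r b n p) =
  \sum_(0 <= i < p) \sum_(0 <= c < b.+1) \sum_(0 <= k < n.+1)
     nlt r c k i * nlt r (b - c) (n - k) (p - 1 - i).
Proof.
rewrite (ncard_fibers (g := fun x => label x.1) (r := index_iota 0 p) (lpairs_finite r b n p) (iota_uniq _ _)); last first.
  by move=> x [Hl _ _ _]; rewrite mem_index_iota /=; lia.
rewrite !big_seq; apply: eq_bigr => i; rewrite mem_index_iota => /andP [_ ip].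
set A1 : set (ltree * ltree) := fun x => _.
have fA1 : finite_set A1 by apply: (sub_finite_set _ (lpairs_finite r b n p)) => x [].
rewrite (ncard_fibers (g := fun x => count_leaves true x.1) (r := index_iota 0 b.+1) fA1 (iota_uniq _ _)); last first.
  by move=> x [[_ _ Hb _] _]; rewrite mem_index_iota /=; lia.
rewrite !big_seq; apply: eq_bigr => c; rewrite mem_index_iota => /andP [_ cb].
set A2 : set (ltree * ltree) := fun x => _.
have fA2 : finite_set A2 by apply: (sub_finite_set _ fA1) => x [].
rewrite (ncard_fibers (g := fun x => count_leaves false x.1) (r := index_iota 0 n.+1) fA2 (iota_uniq _ _)); last first.
  by move=> x [[[_ _ _ Hn] _] _]; rewrite mem_index_iota /=; lia.
rewrite !big_seq; apply: eq_bigr => k; rewrite mem_index_iota => /andP [_ kn].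
rewrite -ncardX; [|exact: ltrees_finite..]; congr ncard.
apply/seteqP; split=> -[t u] /=.
  by move=> [[[[/= Hl [wt wu] Hb Hn] Hi] Hc] Hk]; split; split=> //=; lia.
move=> [/= [lt wt bt nt] [lu wu bu nu]]; split=> //; split=> //; split=> //.
by split=> //=; lia.
Qed.

Lemma nlt_rec r b n p : 0 < p -> nlt r b n p =
  [&& p == r, b == 1 & n == 0] + nlt r b n p.+1 + ncard (lpairs r b n p).
Proof.
move=> p0; rewrite -addnA.
pose L : set ltree := fun t => t = Leaf p true /\ [&& p == r, b == 1 & n == 0].
pose U : set ltree := (Unary p @` ltrees r b n p.+1)%classic.
pose B : set ltree := ((fun x => Binary p x.1 x.2) @` lpairs r b n p)%classic.
have -> : nlt r b n p = ncard (L `|` (U `|` B))%classic.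
  congr ncard; apply/seteqP; split=> t.
    case: t => [l c|l a|l a c] [/= -> wl Eb En].
    - left; case: c wl Eb En => /= Ep; last by lia.
      by move=> Eb En; split=> //; rewrite Ep -Eb -En eqxx.
    - by case: wl => _ la wa; right; left; exists a.
    - by case: wl => _ la wa wc; right; right; exists (a, c).
  case=> [[-> /and3P [/eqP Hp /eqP -> /eqP ->]]|[[a [la wa ba na] <-]|[[a c]]]].
  - by split.
  - by split.
  - by move=> [/= Hl [wa wc] Hb Hn] <-; split.
have fL : finite_set L.
  by apply: (@sub_finite_set _ _ [set Leaf p true]%classic) => // t [->].
have fU : finite_set U by apply: finite_image; exact: ltrees_finite.
have fB : finite_set B by apply: finite_image; exact: lpairs_finite.
rewrite ncardU //; last 2 first.
- by rewrite finite_setU.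
- by move=> t [-> _] [[]|[]].
rewrite ncardU //; last by move=> t [a _ <-] [].
rewrite !ncard_image; last 2 first.
- by move=> [a c] [a' c'] /= [-> ->].
- by move=> a c [].
congr (_ + _); case H: [&& p == r, b == 1 & n == 0].
  apply: (@ncard_seq _ _ [:: Leaf p true]) => // t; rewrite inE /L H.
  by split=> [[->]|/eqP ->].
by apply: ncard0 => t [_]; rewrite H.
Qed.

(** * The first identity *)

(* A marked [PU] becomes the distinguished leaf; [below] is the tree under it. *)
Fixpoint to_ltree (t : ptree) : ltree :=
  match t with
  | PV => Leaf 0 false
  | PJ a b => Binary (pdeg t)./2 (to_ltree a) (to_ltree b)
  | PU _ m a => if m then Leaf (pdeg t)./2 true else Unary (pdeg t)./2 (to_ltree a)
  end.

Fixpoint below (t : ptree) : ptree :=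
  match t with
  | PV => PV
  | PJ a b => if pmarks a == 0 then below b else below a
  | PU _ m a => if m then a else below a
  end.

(** The inverse of the cutting. As [PU k] cuts off a face of degree [k.+1], a quadrangle has [k = 3]
    and the marked face [k = 2q - 1]. *)
Fixpoint fill (q : nat) (s : ptree) (t : ltree) : ptree :=
  match t with
  | Leaf _ c => if c then PU q.*2.-1 true s else PV
  | Unary _ a => PU 3 false (fill q s a)
  | Binary _ a b => PJ (fill q s a) (fill q s b)
  end.

Lemma quad_no_marks t : pall quad_ok t -> pmarks t = 0.
Proof.
elim: t => //= [a IHa b IHb|k c a IHa].
  by move=> /andP [/IHa -> /IHb ->].
by move=> /andP [/andP [/negPf -> _] /IHa ->].
Qed.

Lemma quad_mark_pall q t : 0 < q ->
  pall quad_ok t = pall (quad_mark_ok q) t && (pmarks t == 0).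
Proof.
move=> q0; elim: t => //= [a -> b ->|k c a ->].
  by rewrite addn_eq0 andbACA.
by case: c; rewrite /quad_ok /quad_mark_ok /= ?andbF ?andbA.
Qed.

(** A join adds 2 to the degrees and cutting off a quadrangle subtracts 2, so root degrees stay even
    and their halves obey the label rules; [3 <= pdeg a] says that the unary vertex has a positive
    label. *)
Lemma to_ltree_quad r q s t : pwf t -> pall quad_ok t ->
  [/\ pdeg t = (label (to_ltree t)).*2, well_labeled r (to_ltree t),
      count_leaves true (to_ltree t) = 0,
      count_leaves false (to_ltree t) = pleaves t & fill q s (to_ltree t) = t].
Proof.
elim: t => //= [a IHa b IHb|k c a IHa].
  move=> /andP [wa wb] /andP [pa pb].
  have [da la ta fa ea] := IHa wa pa; have [db lb tb fb eb] := IHb wb pb.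
  rewrite ta tb fa fb ea eb; split=> //.
    by rewrite da db; lia.
  by split=> //; rewrite da db; lia.
move=> /andP [kd wa] /andP [/andP [/negPf -> /eqP [Ek]] pa]; subst k.
have [da la ta fa ea] := IHa wa pa; rewrite /= ea; split=> //.
  by lia.
by split=> //; lia.
Qed.

Lemma fill_quad r q s t : well_labeled r t -> count_leaves true t = 0 ->
  [/\ pwf (fill q s t), pall quad_ok (fill q s t), pdeg (fill q s t) = (label t).*2,
      pleaves (fill q s t) = count_leaves false t & to_ltree (fill q s t) = t].
Proof.
elim: t => //= [l [] /= -> //|l a IHa|l a IHa b IHb].
  move=> [l1 la wa] /(IHa wa) [wfa pa da na ea].
  rewrite da la pa wfa; split=> //; [lia|lia|].
  by rewrite ea; congr Unary; lia.
move=> [l1 lab wa wb] /eqP; rewrite addn_eq0 => /andP [/eqP ca /eqP cb].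
have [wfa pa da na ea] := IHa wa ca; have [wfb pb db nb eb] := IHb wb cb.
rewrite da db wfa wfb pa pb na nb ea eb; split=> //; [lia|].
by congr Binary; lia.
Qed.

Lemma numQ_nlt r n p : 0 < r -> numQ n p = nlt r 0 n p.
Proof.
move=> r0; case: (posnP p) => [->|p0]; first by rewrite nlt0.
rewrite (numQ_ptrees n p0); apply: (@ncard_bij _ _ _ _ to_ltree); split.
- move=> t [wt dt nt pt _]; have [dt' wl ct cf _] := to_ltree_quad r 1 PV wt pt.
  by split; rewrite ?cf //; lia.
- move=> t u; rewrite !inE => -[wt _ _ pt _] [wu _ _ pu _] E.
  have [_ _ _ _ <-] := to_ltree_quad r 1 PV wt pt.
  by have [_ _ _ _ <-] := to_ltree_quad r 1 PV wu pu; rewrite E.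
- move=> t [lt wl ct cf]; have [wf pf df nf ef] := fill_quad 1 PV wl ct.
  exists (fill 1 PV t) => //; split=> //; rewrite ?df ?lt ?nf //.
  exact: quad_no_marks.
Qed.

(** A total of [q.*2] then cannot be shared between the two branches of a join: the marked face lies
    in exactly one. *)
Lemma pmarks_mult q t : pall (quad_mark_ok q) t -> exists m, pmarks t = m * q.*2.
Proof.
elim: t => /= [_|a IHa b IHb|k c a IHa]; first by exists 0.
  by move=> /andP [/IHa [m ->] /IHb [m' ->]]; exists (m + m'); rewrite mulnDl.
move=> /andP [/eqP Ek /IHa [m ->]]; case: c Ek => [->|_]; last by exists m.
by exists m.+1; rewrite mulSn.
Qed.

Lemma to_ltree_marked q t : 0 < q -> pwf t -> pall (quad_mark_ok q) t ->
  pmarks t = q.*2 ->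
  exists r, 0 < r /\
   [/\ pdeg t = (label (to_ltree t)).*2, well_labeled r (to_ltree t),
      count_leaves true (to_ltree t) = 1,
      count_leaves false (to_ltree t) + pleaves (below t) = pleaves t &
      fill q (below t) (to_ltree t) = t] /\
   [/\ pwf (below t), pall quad_ok (below t) & pdeg (below t) = (r + q - 1).*2].
Proof.
move=> q0; elim: t => [|a IHa b IHb|k c a IHa] /=.
- by move=> _ _; lia.
- move=> /andP [wa wb] /andP [pa pb] Em.
  have [ma Ea] := pmarks_mult pa; have [mb Eb] := pmarks_mult pb.
  have Q a' : pall (quad_mark_ok q) a' -> pmarks a' = 0 -> pall quad_ok a'.
    by move=> pa' ma'; rewrite (quad_mark_pall _ q0) pa' ma' eqxx.
  case: eqP => [Ea0|/eqP Ea0].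
    have [|r [r0 [[db lb tb fb eb] H]]] := IHb wb pb; first by lia.
    exists r; split=> //; split=> //.
    have [da la ta fa ea] := to_ltree_quad r q (below b) wa (Q _ pa Ea0).
    rewrite ta tb ea eb fa; split=> //; [lia| |lia].
    by split=> //; lia.
  have Eb0 : pmarks b = 0.
    have : (ma + mb) * q.*2 == 1 * q.*2 by rewrite mulnDl -Ea -Eb mul1n Em.
    rewrite eqn_pmul2r ?double_gt0 // => /eqP Emab.
    by case: ma mb Ea Eb Emab => [|ma] [|mb] Ea Eb; lia.
  have [|r [r0 [[da la ta fa ea] H]]] := IHa wa pa; first by lia.
  exists r; split=> //; split=> //.
  have [db lb tb fb eb] := to_ltree_quad r q (below a) wb (Q _ pb Eb0).
  rewrite ta tb ea eb fb; split=> //; [lia| |lia].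
  by split=> //; lia.
move=> /andP [kd wa] /andP [/eqP Ek pa] Em; case: c Ek Em => Ek Em.
  have pa' : pall quad_ok a by rewrite (quad_mark_pall _ q0) pa; lia.
  have [da _ _ _ _] := to_ltree_quad 1 1 PV wa pa'.
  (* With [k = 2q - 1] this is [pdeg a / 2 + 1 - q], so the subtree has label [r + q - 1]. As
     [pdeg a] is even, [k <= pdeg a] makes [r] positive. *)
  exists ((pdeg a).+1 - k)./2; split; first by lia.
  split; split=> //=; [lia| |lia].
  by congr (PU _ _ _); lia.
have [|r [r0 [[da la ta fa ea] H]]] := IHa wa pa; first by lia.
exists r; split=> //; split=> //=; split=> //; [lia| |].
  by split=> //; lia.
by rewrite ea; case: Ek => ->.
Qed.

Lemma fill_marked q r s t : 0 < q -> 0 < r -> well_labeled r t ->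
  count_leaves true t = 1 -> pwf s -> pall quad_ok s -> pdeg s = (r + q - 1).*2 ->
  [/\ pwf (fill q s t), pall (quad_mark_ok q) (fill q s t),
      pmarks (fill q s t) = q.*2, pdeg (fill q s t) = (label t).*2 &
      pleaves (fill q s t) = count_leaves false t + pleaves s] /\
  (to_ltree (fill q s t) = t /\ below (fill q s t) = s).
Proof.
move=> q0 r0 + + ws ps ds; have ms := quad_no_marks ps.
have Q u : well_labeled r u -> count_leaves true u = 0 ->
  [/\ pwf (fill q s u), pall (quad_mark_ok q) (fill q s u), pmarks (fill q s u) = 0,
      pdeg (fill q s u) = (label u).*2 &
      pleaves (fill q s u) = count_leaves false u] /\ to_ltree (fill q s u) = u.
  move=> wu cu; have [wf pf df nf ef] := fill_quad q s wu cu.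
  by move: (pf); rewrite (quad_mark_pall _ q0) => /andP [-> /eqP].
elim: t => [l c|l a IHa|l a IHa b IHb] /=.
- case: c => //= -> _; rewrite ws ms; split; last first.
    by split=> //; congr Leaf; lia.
  have : pall quad_ok s by []. rewrite (quad_mark_pall _ q0) => /andP [-> _].
  by split=> //; rewrite ?andbT /quad_mark_ok; lia.
- move=> [l1 la wa] /(IHa wa) [[wf pf mf df nf] [ef bf]].
  rewrite wf pf mf df nf ef bf la; split; last by split=> //; congr Unary; lia.
  by split=> //; lia.
move=> [l1 lab wa wb] cab.
have [[ca cb]|[ca cb]] : (count_leaves true a = 0 /\ count_leaves true b = 1) \/
  (count_leaves true a = 1 /\ count_leaves true b = 0) by lia.
  have [[wfa pfa mfa dfa nfa] efa] := Q a wa ca.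
  have [[wfb pfb mfb dfb nfb] [efb bfb]] := IHb wb cb.
  rewrite wfa wfb pfa pfb mfa mfb dfa dfb nfa nfb efa efb bfb /=.
  by split; [split=> //; lia|split=> //; congr Binary; lia].
have [[wfb pfb mfb dfb nfb] efb] := Q b wb cb.
have [[wfa pfa mfa dfa nfa] [efa bfa]] := IHa wa ca.
rewrite wfa wfb pfa pfb mfa mfb dfa dfb nfa nfb efa efb bfa ifN; last by lia.
by split; [split=> //; lia|split=> //; congr Binary; lia].
Qed.

(** The pair determines [r], by the label of the lower tree, and [k], by the leaves of the upper
    one; these are the two indices of the double sum. *)
Definition cut_pairs (n p q : nat) : set (ltree * ltree) := fun x =>
  exists r k, [/\ 0 < r, k <= n, ltrees r 1 k p x.1 &
    ltrees 1 0 (n - k) (r + q - 1) x.2].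

(** The range of summation is forced: the lower tree has [n - k] leaves, all labelled 0, hence a
    label smaller than [n - k]. *)
Lemma cut_pairs_bounds n p q x : 0 < q -> cut_pairs n p q x ->
  exists r k, [/\ r = label x.2 + 1 - q, k = count_leaves false x.1,
    0 < r /\ r + k + q <= n, ltrees r 1 k p x.1 &
    ltrees 1 0 (n - k) (r + q - 1) x.2].
Proof.
move=> q0 [r [k [r0 kn H1 H2]]]; exists r, k.
have [l1 w1 t1 f1] := H1; have [l2 w2 t2 f2] := H2.
have := label_bound w2; rewrite l2 t2 f2 => H.
by split=> //; [lia|split=> //; lia].
Qed.

Lemma numQ2_cut_pairs n p q : 0 < p -> 0 < q ->
  numQ2 n p q = ncard (cut_pairs n p q).
Proof.
move=> p0 q0; rewrite (numQ2_ptrees n p0 q0).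
apply: (@ncard_bij _ _ _ _ (fun t => (to_ltree t, to_ltree (below t)))); split.
- move=> t [wt dt nt pt mt].
  have [r [r0 [[dt' wl ct cf et] [wb pb db]]]] := to_ltree_marked q0 wt pt mt.
  have [db' wlb ctb cfb _] := to_ltree_quad 1 1 PV wb pb.
  exists r, (count_leaves false (to_ltree t)); split=> //=; first by lia.
    by split=> //; lia.
  by split=> //; lia.
- move=> t u; rewrite !inE => -[wt dt nt pt mt] [wu du nu pu mu] [E1 E2].
  have [r [r0 [[_ _ _ _ et] [wb pb _]]]] := to_ltree_marked q0 wt pt mt.
  have [r' [r0' [[_ _ _ _ eu] [wb' pb' _]]]] := to_ltree_marked q0 wu pu mu.
  have [_ _ _ _ ebt] := to_ltree_quad 1 1 PV wb pb.
  have [_ _ _ _ ebu] := to_ltree_quad 1 1 PV wb' pb'.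
  by rewrite -et -eu -ebt -ebu E1 E2.
move=> [t u] [r [k [r0 kn /= [l1 w1 t1 f1] [l2 w2 t2 f2]]]].
have [wu pu du nu eu] := fill_quad 1 PV w2 t2; rewrite l2 in du.
have [[wf pf mf df nf] [ef bf]] := fill_marked q0 r0 w1 t1 wu pu du.
exists (fill q (fill 1 PV u) t); last by rewrite ef bf eu.
by split=> //; [rewrite df l1|rewrite nf nu f1 f2; lia].
Qed.

Lemma numQ2_sum n p q : 0 < p -> 0 < q ->
  numQ2 n p q = \sum_(1 <= r < n.+1) \sum_(0 <= k < n.+1 - (r + q))
      numA k p r * numQ (n - k) (r + q - 1).
Proof.
move=> p0 q0; rewrite numQ2_cut_pairs //.
have fC : finite_set (cut_pairs n p q).
  pose X : set ltree := (\bigcup_(r in `I_n.+1) \bigcup_(k in `I_n.+1) ltrees r 1 k p)%classic.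
  pose Y : set ltree := (\bigcup_(r in `I_n.+1) \bigcup_(k in `I_n.+1)
     ltrees 1 0 (n - k) (r + q - 1))%classic.
  apply: (@sub_finite_set _ _ (X `*` Y)%classic).
    move=> x /(cut_pairs_bounds q0) [r [k [_ _ [r0 H] H1 H2]]].
    by split; exists r => /=; try lia; exists k => /=; try lia.
  by apply: finite_setX; do 2!(apply: bigcup_finite => // ? _); exact: ltrees_finite.
rewrite (ncard_fibers (g := fun x => label x.2 + 1 - q) (r := index_iota 1 n.+1) fC) ?iota_uniq //; last first.
  move=> x /(cut_pairs_bounds q0) [r [k [/= <- _ [r0 H] H1 H2]]].
  by rewrite mem_index_iota; lia.
rewrite !big_seq; apply: eq_bigr => r; rewrite mem_index_iota => /andP [r0 rn].
set A1 : set (ltree * ltree) := fun x => _.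
have fA1 : finite_set A1 by apply: (sub_finite_set _ fC) => x [].
rewrite (ncard_fibers (g := fun x => count_leaves false x.1) (r := index_iota 0 (n.+1 - (r + q))) fA1) ?iota_uniq //; last first.
  move=> x [/(cut_pairs_bounds q0) [r' [k [/= -> <- [r0' H] H1 H2]]] E].
  by rewrite mem_index_iota; lia.
rewrite !big_seq; apply: eq_bigr => k; rewrite mem_index_iota => /andP [_ kn].
rewrite (numQ_nlt _ _ (ltn0Sn 0)).
have -> : numA k p r = nlt r 1 k p by case: r r0 {rn A1 fA1 kn}.
rewrite -ncardX; [|exact: ltrees_finite..]; congr ncard.
apply/seteqP; split=> -[t u].
  by move=> [[/(cut_pairs_bounds q0) [r' [k' [/= -> -> _ H1 H2]]] /= <-] <-].
move=> [/= H1 H2]; have [l2 w2 t2 f2] := H2; have [l1 w1 t1 f1] := H1.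
split; last by []. split; last by rewrite /= l2; lia.
by exists r, k; split=> //=; lia.
Qed.

(** * The second identity *)

Definition conv (f g : nat -> nat) (n : nat) : nat := \sum_(k < n.+1) f k * g (n - k).

Lemma eq_conv f f' g g' n : (forall k, k <= n -> f k = f' k) ->
  (forall k, k <= n -> g k = g' k) -> conv f g n = conv f' g' n.
Proof. by move=> Ef Eg; apply: eq_bigr => -[k kn] _ /=; rewrite Ef ?Eg //; lia. Qed.

Lemma convC f g n : conv f g n = conv g f n.
Proof.
rewrite /conv (reindex_inj rev_ord_inj) /=; apply: eq_bigr => -[k kn] _ /=.
by rewrite mulnC; congr (g _ * f _); lia.
Qed.

Lemma convCA f g h n : conv f (conv g h) n = conv g (conv f h) n.
Proof.
have E f1 g1 h1 : conv f1 (conv g1 h1) n =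
    \sum_(i < n.+1) \sum_(j < n.+1 | i + j <= n) f1 i * (g1 j * h1 (n - (i + j))).
  apply: eq_bigr => -[i iN] _ /=; rewrite /conv big_distrr /=.
  rewrite (big_ord_widen n.+1 (fun j => f1 i * (g1 j * h1 (n - i - j)))); last by lia.
  apply: eq_big => -[j jN] /=; first by lia.
  by move=> _; rewrite subnDA.
rewrite !E (exchange_big_dep xpredT) //=; apply: eq_bigr => i _.
apply: eq_big => j; first by rewrite addnC.
by rewrite mulnCA addnC.
Qed.

Lemma convDr f g h n : conv f (fun k => g k + h k) n = conv f g n + conv f h n.
Proof. by rewrite /conv -big_split; apply: eq_bigr => i _; rewrite mulnDr. Qed.

Lemma conv_sumr f (m : nat) (g : nat -> nat -> nat) n :
  conv f (fun k => \sum_(j < m) g j k) n = \sum_(j < m) conv f (g j) n.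
Proof.
rewrite /conv exchange_big /=; apply: eq_bigr => i _; by rewrite big_distrr.
Qed.

Lemma conv_delta f n (b : bool) : conv f (fun k => b && (k == 0)) n = b * f n.
Proof.
rewrite /conv big_ord_recr /= subnn eqxx andbT big1 ?add0n; first by rewrite mulnC.
by move=> -[i iN] _ /=; rewrite (_ : n - i == 0 = false) ?andbF ?muln0 //; lia.
Qed.

Section PeelingRecursion.
Variable q : nat -> nat -> nat.
Hypothesis q_0 : forall p, q p 0 = 0.

Definition peel_step (F : nat -> nat -> nat) (p n : nat) : nat :=
  F p.+1 n + 2 * \sum_(j < p) conv (q j) (F (p - 1 - j)) n.

(* [F p] is the series of the walks from [p] to [s] that stay above 0 (if
   [s > 0]), or that are stopped at 0 (if [s = 0]), whose steps are +1 with
   weight 1 and -(j+1) with weight twice the series [q j]. *)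
Definition walk_series (s : nat) (F : nat -> nat -> nat) : Prop :=
  [/\ forall n, F 0 n = (0 == s) && (n == 0),
      forall p n, 0 < p -> F p n = ((p == s) && (n == 0)) + peel_step F p n &
      forall p n, n + s < p -> F p n = 0].

(** The recursion raises [p] at constant [n], or lowers [n] because [q] has no constant term. Hence
    an induction on [n] and, inside, a descending one on [p], started by the vanishing for large
    [p]. *)
Lemma peel_uniq (d F G : nat -> nat -> nat) c :
  (forall n, F 0 n = G 0 n) ->
  (forall p n, 0 < p -> F p n = d p n + peel_step F p n) ->
  (forall p n, 0 < p -> G p n = d p n + peel_step G p n) ->
  (forall p n, n + c < p -> F p n = 0) -> (forall p n, n + c < p -> G p n = 0) ->
  forall n p, F p n = G p n.
Proof.
move=> E0 EF EG VF VG n; have [m] := ubnP n; elim: m n => // m IH n nm p.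
have [k] := ubnP (n + c + 1 - p); elim: k p => // k IHk p kp.
case: (posnP p) => [->|p0]; first exact: E0.
case: (ltnP (n + c) p) => [np|pn]; first by rewrite VF // VG.
rewrite EF // EG // /peel_step IHk; last by lia.
congr (_ + (_ + 2 * _)); apply: eq_bigr => j _.
apply: eq_bigr => -[[|i] iN] _ /=; first by rewrite q_0.
by rewrite IH //; lia.
Qed.

(** From 1 a walk can only step up to 2; after its last visit to 1 (before the end, if [s = 0]) it
    is, lowered by one, a walk counted by [b 1]. A walk without such a visit is, lowered by one,
    counted by [b p.-1]. *)
Lemma walk_last_visit s b c d : walk_series s b -> walk_series s.+1 c ->
  walk_series 1 d -> forall n p, 0 < p -> c p n = b p.-1 n + conv (b 1) (d p) n.
Proof.
move=> [b0 bS bV] [c0 cS cV] [d0 dS dV].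
pose bs p n := if p is p'.+1 then b p' n else 0.
pose G p n := bs p n + conv (b 1) (d p) n.
suff H : forall n p, c p n = G p n.
  by move=> n [|p] // _; rewrite H.
apply: (@peel_uniq (fun p n => (p == s.+1) && (n == 0)) _ _ s.+1) => //.
- move=> n; rewrite c0 /G; rewrite (@eq_conv _ (b 1) _ (fun=> 0)) //.
  by rewrite /conv big1 // => i _; rewrite muln0.
(* The source of [d] at 1 contributes [b 1 n]. It supplies the upward step that [bs] lacks at
   [p = 1], where [bs 1 = b 0] satisfies no recursion. *)
- have dE p n : 0 < p -> conv (b 1) (d p) n =
     (p == 1) * b 1 n + conv (b 1) (d p.+1) n +
       2 * \sum_(j < p) conv (q j) (conv (b 1) (d (p - 1 - j))) n.
    move=> p0; under eq_conv => [k _|k _] do [|rewrite dS //].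
    rewrite convDr conv_delta /peel_step convDr addnA; congr (_ + _).
    have -> : forall f, conv (b 1) (fun k => 2 * f k) n = 2 * conv (b 1) f n.
      by move=> f; rewrite /conv big_distrr; apply: eq_bigr => i _; rewrite mulnCA.
    rewrite (@conv_sumr _ p (fun j k => conv (q j) (d (p - 1 - j)) k)).
    congr (_ * _); apply: eq_bigr => j _; exact: convCA.
  have bsE p n : \sum_(j < p.+1) conv (q j) (bs (p.+1 - 1 - j)) n =
      \sum_(j < p) conv (q j) (b (p - 1 - j)) n.
    rewrite subn1 big_ord_recr /= subnn [X in _ + X]big1 ?addn0; last first.
      by move=> i _; rewrite muln0.
    apply: eq_bigr => -[j jp] _ /=; apply: eq_conv => // k _.
    by rewrite (_ : p - j = (p - 1 - j).+1) //; lia.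
  move=> [|p] n // _; rewrite /peel_step /G dE //.
  under [in RHS]eq_bigr => j _ do rewrite convDr.
  rewrite big_split /= bsE eqSS; case: p => [|p].
    by rewrite big_ord0 b0 mul1n; lia.
  by rewrite bS // /peel_step mul0n; lia.
move=> [|p] n // H; rewrite /G /= bV ?add0n; last by lia.
by rewrite /conv big1 // => -[i iN] _ /=; rewrite dV ?muln0 //; lia.
Qed.

End PeelingRecursion.

(** Leibniz' rule for the derivative of a product of two series, at the coefficient of order [n]. *)
Lemma conv_deriv f g n : f 0 = 0 -> g 0 = 0 ->
  n.+1 * conv f g n.+1 =
    conv (fun k => k.+1 * f k.+1) g n + conv f (fun k => k.+1 * g k.+1) n.
Proof.
move=> f0 g0; rewrite {1}/conv big_distrr /=.
have -> : \sum_(i < n.+2) n.+1 * (f i * g (n.+1 - i)) =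
    \sum_(i < n.+2) (i * f i) * g (n.+1 - i) +
    \sum_(i < n.+2) f i * ((n.+1 - i) * g (n.+1 - i)).
  rewrite -big_split; apply: eq_bigr => -[i iN] _ /=.
  have E : n.+1 = i + (n.+1 - i) by lia.
  move: (f i) (g (n.+1 - i)) (n.+1 - i) E => a c m ->.
  by rewrite mulnDl mulnA; congr (_ + _); rewrite mulnCA.
rewrite big_ord_recl mul0n add0n; congr (_ + _).
rewrite big_ord_recr /= subnn mul0n muln0 addn0; apply: eq_bigr => -[i iN] _ /=.
by rewrite subSn.
Qed.

(* There is no distinguished leaf, whose label [1] is therefore irrelevant. *)
Definition numQ_series (p n : nat) : nat := nlt 1 0 n p.

Lemma nlt_Q r n p : 0 < r -> nlt r 0 n p = numQ_series p n.
Proof. by move=> r0; rewrite -numQ_nlt // (@numQ_nlt 1). Qed.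

Lemma numQ_series_0 p : numQ_series p 0 = 0.
Proof. by rewrite /numQ_series nlt_bound. Qed.

Lemma numQ_series_rec p n : 0 < p -> numQ_series p n =
  numQ_series p.+1 n + \sum_(j < p) conv (numQ_series j) (numQ_series (p - 1 - j)) n.
Proof.
move=> p0; rewrite /numQ_series nlt_rec // andbF add0n ncard_lpairs; congr (_ + _).
rewrite big_mkord; apply: eq_bigr => j _; rewrite big_nat1 big_mkord.
by apply: eq_bigr => k _; rewrite subn0.
Qed.

Lemma numQ_series_bound p n : n <= p -> numQ_series p n = 0.
Proof. by move=> np; rewrite /numQ_series nlt_bound //; lia. Qed.

(** At a binary vertex the branch goes on to one child, and the other child, of label [j], roots a
    tree without distinguished leaf. The two choices give equal sums. *)
Lemma walk_series_leaves r : 0 < r ->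
  walk_series numQ_series r (fun p n => nlt r 1 n p).
Proof.
move=> r0; split.
- by move=> n; rewrite nlt0 //= eq_sym; case: r r0.
- move=> p n p0; rewrite nlt_rec // eqxx /= -addnA; congr (_ + (_ + _)).
  rewrite ncard_lpairs big_mkord mul2n -addnn.
  have E1 : \sum_(j < p) conv (numQ_series j) (fun k => nlt r 1 k (p - 1 - j)) n =
      \sum_(j < p) \sum_(k < n.+1) nlt r 0 k j * nlt r 1 (n - k) (p - 1 - j).
    by apply: eq_bigr => j _; apply: eq_bigr => k _; rewrite nlt_Q.
  have E2 : \sum_(j < p) conv (numQ_series j) (fun k => nlt r 1 k (p - 1 - j)) n =
      \sum_(j < p) \sum_(k < n.+1) nlt r 1 k j * nlt r 0 (n - k) (p - 1 - j).
    rewrite (reindex_inj rev_ord_inj) /=; apply: eq_bigr => -[j jp] _ /=.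
    rewrite convC; apply: eq_bigr => k _; rewrite nlt_Q //.
    by congr (nlt _ _ _ _ * numQ_series _ _); lia.
  rewrite {1}E1 E2 -big_split /=; apply: eq_bigr => -[j jp] _ /=.
  by rewrite big_ltn // big_nat1 !big_mkord.
- by move=> p n np; apply: nlt_bound; lia.
Qed.

(** Multiplying by [n.+1] distinguishes a leaf of label 0, or differentiates the series. Applied to
    the quadratic recursion of [numQ_series], Leibniz' rule gives two sums, exchanged by swapping
    the children. *)
Lemma walk_series_vertices :
  walk_series numQ_series 0 (fun p n => n.+1 * numQ_series p n.+1).
Proof.
split.
- by move=> n; rewrite /numQ_series nlt0 // eqSS; case: n => //= n; rewrite muln0.
- move=> p n p0; rewrite (_ : p == 0 = false) ?add0n; last by lia.
  rewrite {1}numQ_series_rec // mulnDr /peel_step; congr (_ + _).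
  rewrite big_distrr /=; under eq_bigr => j _ do rewrite conv_deriv ?numQ_series_0 //.
  rewrite big_split /= mul2n -addnn; congr (_ + _).
  rewrite (reindex_inj rev_ord_inj) /=; apply: eq_bigr => -[j jp] _ /=.
  rewrite convC; apply: eq_conv => k _; first by congr numQ_series; lia.
  by congr (_ * numQ_series _ _); lia.
- by move=> p n np; rewrite numQ_series_bound ?muln0 //; lia.
Qed.

Lemma numA_leaves r n p : 0 < r -> numA n p r = nlt r 1 n p.
Proof. by case: r. Qed.

(** The cutoff in the definition of [numA] only discards values that are already 0, since a map with
    root degree [2p] has more than [p] vertices. *)
Lemma numA_vertices n p : 0 < p -> numA n p 0 = n.+1 * numQ_series p n.+1.
Proof.
move=> p0; rewrite /numA (@numQ_nlt 1) //; case: ifP => // H.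
by rewrite -/(numQ_series p n.+1) numQ_series_bound ?muln0 //; lia.
Qed.

Lemma numA_last_visit r p n : 0 < r -> 0 < p -> 0 < n ->
  numA n p r = numA n (maxn (p - 1) 1) (r - 1)
    + \sum_(0 <= k < n) numA k 1 (r - 1) * numA (n - k) p 1.
Proof.
case: r => // s _ p0 n0; rewrite (_ : s.+1 - 1 = s); last by lia.
pose c := fun p n => nlt s.+1 1 n p; pose d := fun p n => nlt 1 1 n p.
have wc : walk_series numQ_series s.+1 c := walk_series_leaves (ltn0Sn s).
have wd : walk_series numQ_series 1 d := walk_series_leaves (ltn0Sn 0).
have [b [wb Eb]] : exists b, walk_series numQ_series s b /\
    forall p n, 0 < p -> numA n p s = b p n.
  case: (posnP s) => [->|s0].
    by exists (fun p n => n.+1 * numQ_series p n.+1); split;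
      [exact: walk_series_vertices|move=> ? ?; exact: numA_vertices].
  by exists (fun p n => nlt s 1 n p); split;
    [exact: walk_series_leaves|move=> *; exact: numA_leaves].
transitivity (c p n); first exact: numA_leaves.
rewrite (walk_last_visit numQ_series_0 wb wc wd) //.
rewrite /conv big_ord_recr /= subnn big_mkord.
have -> : \sum_(k < n) numA k 1 s * numA (n - k) p 1 = \sum_(k < n) b 1 k * d p (n - k).
  by apply: eq_bigr => k _; rewrite Eb // numA_leaves.
have [b0 _ _] := wb; have [d0 dS dV] := wd.
rewrite Eb ?leq_max ?orbT // addnCA addnC; congr (_ + _).
(* The convolution has one term more than the sum of the identity, [b 1 n * d p 0]. For [p = 1] it
   equals [b 1 n], while [b 0 n] vanishes as [n > 0]; for [p > 1] it vanishes and [b p.-1 n]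
   remains. Hence the maximum. *)
case: p p0 => // -[|p] _; rewrite subn1 /=.
  rewrite b0 dS // /peel_step dV // big_ord_recr big_ord0 /= /conv big_ord_recr big_ord0 /=.
  rewrite d0 !muln0 !addn0 muln1 (_ : n == 0 = false) ?andbF ?addn0 //; lia.
by rewrite dV ?muln0 ?addn0 //; lia.
Qed.

Theorem mainTheorem5 :
  (forall p q n : nat, 1 <= p -> 1 <= q -> 1 <= n ->
     numQ2 n p q =
       \sum_(1 <= r < n.+1) \sum_(0 <= k < n.+1 - (r + q))
          numA k p r * numQ (n - k) (r + q - 1))
  /\
  (forall r p n : nat, 1 <= r -> 1 <= p -> 1 <= n ->
     numA n p r =
       numA n (maxn (p - 1) 1) (r - 1)
       + \sum_(0 <= k < n) numA k 1 (r - 1) * numA (n - k) p 1).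
Proof.
split=> [p q n p0 q0 _|r p n]; first exact: numQ2_sum.
exact: numA_last_visit.
Qed.
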